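(* Let $M$ be a Hausdorff, separable, finite dimensional differentiable manifold, $(C^\infty(M),\mathfrak{X}(M))$ the Lie Rinehart pair of smooth functions and vector fields on $M$, and $\bigwedge\mathfrak{X}(M)_{C^\infty(M)}$ its exterior algebra, i.e. the algebra of multivector fields on $M$. Then the only naturally defined (co)differential $$\textstyle d:\bigwedge\mathfrak{X}(M)_{C^\infty(M)}\to\bigwedge\mathfrak{X}(M)_{C^\infty(M)},$$ homogeneous of degree $-1$ with respect to the tensor grading, is the zero operator.
   Context: $\bigwedge\mathfrak{X}(M)_{C^\infty(M)}=\bigoplus_{n\ge0}\bigwedge^n_{C^\infty(M)}\mathfrak{X}(M)$ is the exterior algebra of the $C^\infty(M)$-module $\mathfrak{X}(M)$; its degree $n$ part is identified with the space $\Gamma(\bigwedge^nTM)$ of smooth $n$-vector fields, and $n$ is the tensor degree. A (co)differential of degree $-1$ is an $\mathbb{R}$-linear map $d$ with $d(\bigwedge^n)\subseteq\bigwedge^{n-1}$ for all $n$ (with $\bigwedge^{-1}=0$) and $d\circ d=0$. ''Naturally defined'' means that $d$ is a natural operator in the sense of Kolář–Michor–Slovák: with $m=\dim M$, $d=d_M$ is a member of a family $(d_N)_N$ of such maps $d_N$ on multivector fields, indexed by all (Hausdorff, separable) smooth $m$-dimensional manifolds $N$, such that (i) $d_{N'}(\varphi_*s)=\varphi_*(d_N s)$ for every diffeomorphism $\varphi:N\to N'$ and every multivector field $s$ on $N$; (ii) $d_U(s|_U)=(d_Ns)|_U$ for every open submanifold $U\subseteq N$; and (iii) each $d_N$ maps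 smoothly parametrized families of multivector fields to smoothly parametrized families. *)

(* Defs.v *)
From HB Require Import structures.
From mathcomp Require Import all_boot all_order all_algebra.
From mathcomp Require Import all_classical all_reals all_analysis.

Set Implicit Arguments.
Unset Strict Implicit.
Unset Printing Implicit Defensive.

Import Order.TTheory GRing.Theory Num.Theory.
Import numFieldNormedType.Exports.

Local Open Scope classical_set_scope.
Local Open Scope ring_scope.

Section Smooth.
Context {R : realType}.

(* Only meaningful for open [U]. *)
Fixpoint Ck (k n : nat) (U : set 'rV[R]_n) (f : 'rV[R]_n -> R) : Prop :=
  (forall p, U p -> {for p, continuous f}) /\
  if k is k'.+1 then
    forall i : 'I_n, (forall p, U p -> derivable f p (delta_mx 0 i)) /\
                     Ck k' U ('D_(delta_mx 0 i) f)
  else True.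

(* The function [f \o c^-1] on [c @` D], for [c] injective on [D]; it takes the
   value 0 outside [c @` D]. *)
Definition local_rep (T : Type) (n : nat) (D : set T) (c : T -> 'rV[R]_n)
    (f : T -> R) (p : 'rV[R]_n) : R :=
  xget 0 (f @` (D `&` c @^-1` [set p])).

Definition smooth_via (T : Type) (n : nat) (D : set T) (c : T -> 'rV[R]_n)
    (f : T -> R) : Prop :=
  forall k, Ck k (c @` D) (local_rep D c f).

Lemma Ck_sub k n (U V : set 'rV[R]_n) f : V `<=` U -> Ck k U f -> Ck k V f.
Proof.
move=> VU; elim: k f => [|k IH] f /= [cf df].
  by split=> // p /VU; exact: cf.
split=> [p /VU|i]; first exact: cf.
have [dfi Cf] := df i; split=> [p /VU|]; [exact: dfi|exact: IH].
Qed.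

Lemma Ck_eq k n (U : set 'rV[R]_n) f g : open U ->
  (forall p, U p -> f p = g p) -> Ck k U f -> Ck k U g.
Proof.
move=> oU.
have near_fg (f' g' : 'rV[R]_n -> R) p : (forall p, U p -> f' p = g' p) -> U p ->
    \forall x \near p, f' x = g' x.
  by move=> fg Up; apply: (filterS fg); apply: open_nbhs_nbhs; split.
have cfg (f' g' : 'rV[R]_n -> R) p : (forall p, U p -> f' p = g' p) -> U p ->
    {for p, continuous f'} -> {for p, continuous g'}.
  move=> fg Up cf; rewrite /prop_for /continuous_at -fg//.
  exact: cvg_trans (@near_eq_cvg _ _ (nbhs p) _ _ _ (near_fg _ _ _ fg Up)) cf.
elim: k f g => [|k IH] f g fg /= [cf df].
  by split=> // p Up; apply: (cfg f) => //; exact: cf.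
split=> [p Up|i]; first by apply: (cfg f) => //; exact: cf.
have [dfi Cf] := df i; split=> [p Up|].
  by apply: near_eq_derivable (dfi p Up); exact: near_fg.
by apply: IH Cf => p Up; apply: near_eq_derive; exact: near_fg.
Qed.

Lemma Ck0 k n (U : set 'rV[R]_n) : Ck k U (cst 0).
Proof.
elim: k => [|k IH] /=; first by split=> // p _; exact: cst_continuous.
split=> [p _|i]; first exact: cst_continuous.
split=> [p _|]; first exact: derivable_cst.
by rewrite (_ : 'D_(delta_mx 0 i) _ = cst 0)//; apply/funext => p; exact: derive_cst.
Qed.

Lemma Ck_lin k n (U : set 'rV[R]_n) (a : R) f g : open U ->
  Ck k U f -> Ck k U g -> Ck k U (fun p => a * f p + g p).
Proof.
move=> oU.
have clin (f' g' : 'rV[R]_n -> R) p : {for p, continuous f'} ->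
    {for p, continuous g'} -> {for p, continuous (fun p => a * f' p + g' p)}.
  move=> cf cg; apply: (@continuousD R R _ (fun p => a * f' p) g' p) => //.
  by apply: (@continuousM R _ (cst a) f' p) => //; exact: cst_continuous.
elim: k f g => [|k IH] f g /= [cf df] [cg dg].
  by split=> // p Up; apply: clin; [exact: cf|exact: cg].
split=> [p Up|i]; first by apply: clin; [exact: cf|exact: cg].
have [dfi Cf] := df i; have [dgi Cg] := dg i.
split=> [p Up|].
  by apply: derivableD; [apply: derivableZ; exact: dfi|exact: dgi].
apply: Ck_eq (IH _ _ Cf Cg) => // p Up.
rewrite [RHS](deriveD (f := a *: f))//; last exact: dgi.
  by rewrite deriveZ//; exact: dfi.
by apply: derivableZ; exact: dfi.
Qed.

Lemma local_repE (T : Type) n (D : set T) (c : T -> 'rV[R]_n) f x :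
  set_inj D c -> D x -> local_rep D c f (c x) = f x.
Proof.
move=> cI Dx; apply: xget_unique; first by exists x.
move=> _ [y [Dy /= cyx] <-]; congr f.
by apply: cI => //; apply/mem_set.
Qed.

Lemma smooth_via0 (T : Type) n (D : set T) (c : T -> 'rV[R]_n) :
  smooth_via D c (cst 0).
Proof.
move=> k; rewrite (_ : local_rep _ _ _ = cst 0); first exact: Ck0.
apply/funext => p; rewrite /local_rep; case: xgetP => // y _.
by case=> x _ <-.
Qed.

Lemma smooth_via_lin (T : Type) n (D : set T) (c : T -> 'rV[R]_n) a f g :
  set_inj D c -> open (c @` D) -> smooth_via D c f -> smooth_via D c g ->
  smooth_via D c (fun x => a * f x + g x).
Proof.
move=> cI oD sf sg k; apply: Ck_eq (Ck_lin a oD (sf k) (sg k)) => //.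
by move=> _ [x Dx <-]; rewrite !local_repE.
Qed.

Lemma smooth_via_comp (T T' : Type) n (D : set T) (c : T -> 'rV[R]_n) f
    (h : T' -> T) (D' : set T') :
  injective h -> set_inj D c -> h @` D' `<=` D -> open ((c \o h) @` D') ->
  smooth_via D c f -> smooth_via D' (c \o h) (f \o h).
Proof.
move=> hI cI hD oD' sf k.
have sub : (c \o h) @` D' `<=` c @` D.
  by move=> _ [x D'x <-]; exists (h x) => //; apply: hD; exists x.
apply: Ck_eq (Ck_sub sub (sf k)) => // _ [x D'x <-].
have Dh y : D' y -> D (h y) by move=> D'y; apply: hD; exists y.
rewrite /= local_repE//; last exact: Dh.
rewrite -[RHS]/(local_rep D' (c \o h) (f \o h) ((c \o h) x)) local_repE//.
move=> y z /set_mem/Dh Dy /set_mem/Dh Dz /= /cI e; apply: hI.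
by apply: e; apply/mem_set.
Qed.

End Smooth.

Section Charts.
Context {R : realType}.

(* A homeomorphism from the open set [dom] onto an open subset of R^m; the values
   of [coord] outside [dom] are irrelevant. *)
Record chart (T : topologicalType) (m : nat) := Chart {
  dom : set T;
  coord :> T -> 'rV[R]_m;
  dom_open : open dom;
  coord_inj : set_inj dom coord;
  coord_continuous : forall x, dom x -> {for x, continuous coord};
  coord_open : forall V : set T, open V -> V `<=` dom -> open (coord @` V)
}.

Definition map_dom (T T' : topologicalType) m m' (f : T -> T')
    (c : chart T m) (c' : chart T' m') : set T :=
  dom c `&` f @^-1` dom c'.

Definition smooth_in (T T' : topologicalType) m m' (f : T -> T')
    (c : chart T m) (c' : chart T' m') : Prop :=
  forall b : 'I_m', smooth_via (map_dom f c c') c (fun x => c' (f x) 0 b).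

(* The matrix of the differential of [f] at [x]; it acts on row vectors. *)
Definition jac (T T' : topologicalType) m m' (f : T -> T')
    (c : chart T m) (c' : chart T' m') (x : T) : 'M[R]_(m, m') :=
  \matrix_(a, b) 'D_(delta_mx 0 a)
    (local_rep (map_dom f c c') c (fun y => c' (f y) 0 b)) (c x).

Lemma map_dom_inj (T T' : topologicalType) m m' (f : T -> T')
    (c : chart T m) (c' : chart T' m') : set_inj (map_dom f c c') c.
Proof.
by move=> x y /set_mem[xc _] /set_mem[yc _]; apply: coord_inj; apply/mem_set.
Qed.

End Charts.
Arguments chart : clear implicits.

Definition separable_space (T : topologicalType) : Prop :=
  exists2 A : set T, countable A & dense A.

(* The smooth structure is given by an atlas that need not be maximal. *)
Record manifold (R : realType) (m : nat) := Manifold {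
  carrier :> topologicalType;
  atlas_index : Type;
  atlas : atlas_index -> chart R carrier m;
  atlas_cover : forall x : carrier, exists i, dom (atlas i) x;
  atlas_compat : forall i j, smooth_in id (atlas i) (atlas j);
  manifold_hausdorff : hausdorff_space carrier;
  manifold_separable : separable_space carrier
}.

Section Maps.
Context {R : realType} {m m' : nat}.

Definition smooth_map (N : manifold R m) (N' : manifold R m') (f : N -> N') :=
  continuous f /\
  forall (i : atlas_index N) (j : atlas_index N'), smooth_in f (atlas i) (atlas j).

End Maps.

Definition diffeomorphism (R : realType) (m : nat) (N N' : manifold R m)
    (f : N -> N') : Prop :=
  smooth_map f /\
  exists g : N' -> N, [/\ smooth_map g, cancel f g & cancel g f].

Section OpenSubmanifold.
Context {R : realType} {m : nat}.
Variables (N : manifold R m) (U : set N) (oU : open U).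

Let incl : set_type U -> N := set_val.

Lemma incl_inj : injective incl.
Proof. exact: val_inj. Qed.

Lemma incl_continuous : continuous incl.
Proof. exact: initial_continuous. Qed.

Lemma incl_open (V : set (set_type U)) : open V -> open (incl @` V).
Proof.
move=> [W oW <-]; rewrite (_ : _ @` _ = W `&` U); first exact: openI.
apply/seteqP; split=> [_ [x Wx <-]|x [Wx Ux]].
  by split=> //; exact: set_valP.
by exists (exist _ x (mem_set Ux)).
Qed.

Section RestrictChart.
Variable c : chart R N m.
Let D : set (set_type U) := incl @^-1` dom c.

Let rD_open : open D.
Proof. by apply: open_comp; [move=> x _; exact: incl_continuous|exact: dom_open]. Qed.

Let rcoord_inj : set_inj D (c \o incl).
Proof.
move=> x y /set_mem Dx /set_mem Dy e; apply: incl_inj.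
by apply: (coord_inj (c := c)) => //; apply/mem_set.
Qed.

Let rcoord_continuous x : D x -> {for x, continuous (c \o incl)}.
Proof.
move=> Dx; apply: continuous_comp; first exact: incl_continuous.
exact: coord_continuous.
Qed.

Let rcoord_open (V : set (set_type U)) :
  open V -> V `<=` D -> open ((c \o incl) @` V).
Proof.
move=> oV VD; rewrite -image_comp.
apply: coord_open; first exact: incl_open.
by move=> _ [x /VD Dx <-].
Qed.

Definition restrict_chart : chart R (set_type U) m :=
  Chart rD_open rcoord_inj rcoord_continuous rcoord_open.

End RestrictChart.

Lemma restrict_open (D : set N) (c : chart R N m) : open D -> D `<=` dom c ->
  open ((c \o incl) @` (incl @^-1` D)).
Proof.
move=> oD Dc; apply: (coord_open (c := restrict_chart c)) => [|x /Dc//].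
by apply: open_comp => // x _; exact: incl_continuous.
Qed.

Lemma map_dom_id_open (c c' : chart R N m) : open (map_dom id c c').
Proof. by apply: openI; exact: dom_open. Qed.

Lemma restrict_open_map_dom (c c' : chart R N m) :
  open ((c \o incl) @` (incl @^-1` map_dom id c c')).
Proof. by apply: restrict_open; [exact: map_dom_id_open|move=> x []]. Qed.

Lemma restrict_jac (c c' : chart R N m) (x : set_type U) :
  map_dom id c c' (incl x) ->
  jac id (restrict_chart c) (restrict_chart c') x = jac id c c' (incl x).
Proof.
move=> Dx; apply/matrixP => a b; rewrite !mxE; apply: near_eq_derive.
have /open_nbhs_nbhs : open_nbhs (c (incl x))
    ((c \o incl) @` (incl @^-1` map_dom id c c')).
  by split; [exact: restrict_open_map_dom|exists x].
apply: filterS => _ [y Dy <-].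
rewrite [LHS](local_repE (c := restrict_chart c))//; last exact: map_dom_inj.
by rewrite [RHS](local_repE (c := c))//; exact: map_dom_inj.
Qed.

Let sub_cover (x : set_type U) :
  exists i : atlas_index N, dom (restrict_chart (atlas i)) x.
Proof. by have [i ix] := atlas_cover (incl x); exists i. Qed.

Let sub_compat (i j : atlas_index N) :
  smooth_in id (restrict_chart (atlas i)) (restrict_chart (atlas j)).
Proof.
move=> b; apply: (smooth_via_comp incl_inj _ _ _ (atlas_compat i j b)).
- exact: map_dom_inj.
- by move=> _ [x Dx <-].
- exact: restrict_open_map_dom.
Qed.

Let sub_hausdorff : hausdorff_space (set_type U).
Proof.
move=> x y cxy; apply: incl_inj; apply: manifold_hausdorff => A B Ax By.
have /cxy /(_ (incl_continuous By)) : nbhs x (incl @^-1` A).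
  exact: incl_continuous.
by case=> z [Az Bz]; exists (incl z).
Qed.

Let sub_separable : separable_space (set_type U).
Proof.
have [A cA dA] := manifold_separable N.
exists (incl @^-1` A).
  have /countable_injP[f fI] := cA; apply/countable_injP.
  exists (f \o incl) => x y /set_mem Ax /set_mem Ay e.
  by apply: incl_inj; apply: fI => //; apply/mem_set.
move=> V [x Vx] oV.
have [|_ [[y Vy <-] Ay]] := dA (incl @` V) _ (incl_open oV); first by exists (incl x), x.
by exists y.
Qed.

Definition open_submanifold : manifold R m :=
  Manifold sub_cover sub_compat sub_hausdorff sub_separable.

End OpenSubmanifold.

(* The exterior algebra of R^m, graded by the cardinality of the index sets: the
   basis vector indexed by I = {i_1 < ... < i_n} is e_(i_1) /\ ... /\ e_(i_n). *)
Notation ext R m := {ffun {set 'I_m} -> R^o}.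

Section Exterior.
Context {R : realType}.

(* The minor of [A] with rows [I] and columns [J], when these have the same size. *)
Definition minor m m' (A : 'M[R]_(m, m')) (I : {set 'I_m}) (J : {set 'I_m'}) : R :=
  if #|I| =P #|J| is ReflectT IJ then
    \det (\matrix_(a < #|I|, b < #|I|) A (enum_val a) (enum_val (cast_ord IJ b)))
  else 0.

(* The map induced on exterior algebras by the linear map e_a |-> \sum_b A a b e_b. *)
Definition ext_map m m' (A : 'M[R]_(m, m')) (v : ext R m) : ext R m' :=
  [ffun J => \sum_I minor A I J * v I].

Lemma ext_map_lin m m' (A : 'M[R]_(m, m')) a (v w : ext R m) :
  ext_map A (a *: v + w) = a *: ext_map A v + ext_map A w.
Proof.
apply/ffunP => J; rewrite !ffunE scaler_sumr -big_split.
by apply: eq_bigr => I _; rewrite !ffunE mulrDr -scalerAr.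
Qed.

End Exterior.

Section MultivectorFields.
Context {R : realType} {m : nat}.

(* A section of the exterior bundle of the tangent bundle is given by its
   components in each chart, related by the exterior powers of the Jacobian
   matrices of the transition maps. The components are set to 0 outside the
   domain of the chart, so that equal sections are equal as functions. *)
Definition is_mvf (N : manifold R m) : {pred atlas_index N -> N -> ext R m} :=
  fun s => `[< [/\ forall i x, ~ dom (atlas i) x -> s i x = 0,
    forall i j x, map_dom id (atlas i) (atlas j) x ->
      s j x = ext_map (jac id (atlas i) (atlas j) x) (s i x) &
    forall i I, smooth_via (dom (atlas i)) (atlas i) (fun x => s i x I)] >].

Lemma is_mvf_submod (N : manifold R m) : GRing.submod_closed (@is_mvf N).
Proof.
split.
  apply/asboolP; split=> //.
    by move=> i j x _; apply/ffunP => J; rewrite !ffunE big1// => I _; rewrite ffunE mulr0.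
  move=> i I; rewrite (_ : (fun _ => _) = cst 0); first exact: smooth_via0.
  by apply/funext => x; rewrite ffunE.
move=> a s t /asboolP[s0 sT sS] /asboolP[t0 tT tS]; apply/asboolP; split.
- by move=> i x ix; rewrite !fctE s0// t0// scaler0 addr0.
- by move=> i j x ijx; rewrite !fctE (sT i j)// (tT i j)// ext_map_lin.
move=> i I; rewrite (_ : (fun _ => _) = fun x => a * s i x I + t i x I).
  apply: smooth_via_lin => //; first exact: coord_inj.
  by apply: coord_open => //; exact: dom_open.
by apply/funext => x; rewrite !fctE !ffunE.
Qed.

HB.instance Definition _ (N : manifold R m) :=
  GRing.isSubmodClosed.Build R (atlas_index N -> N -> ext R m) (@is_mvf N)
    (@is_mvf_submod N).

(* Smooth multivector fields, not necessarily homogeneous. *)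
Record mvf (N : manifold R m) := Mvf {
  components :> atlas_index N -> N -> ext R m;
  componentsP : components \in @is_mvf N
}.

HB.instance Definition _ (N : manifold R m) := [isSub for @components N].
HB.instance Definition _ (N : manifold R m) := [Choice of mvf N by <:].
HB.instance Definition _ (N : manifold R m) :=
  [SubChoice_isSubLmodule of mvf N by <:].

(* Multivector fields of tensor degree [n]. *)
Definition homog (N : manifold R m) (n : nat) (s : mvf N) : Prop :=
  forall i x (I : {set 'I_m}), s i x I != 0 -> #|I| = n.

Lemma restrict_is_mvf (N : manifold R m) (U : set N) (oU : open U) (s : mvf N) :
  (fun i (x : open_submanifold oU) => s i (set_val x)) \in
  @is_mvf (open_submanifold oU).
Proof.
have /asboolP[s0 sT sS] := componentsP s; apply/asboolP; split.
- by move=> i x ix; exact: s0.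
- by move=> i j x ijx; rewrite restrict_jac//; exact: sT.
move=> i I; have D'D : set_val @` (set_val @^-1` dom (@atlas _ _ N i) : set U)
    `<=` dom (@atlas _ _ N i) by move=> _ [x ix <-].
apply: smooth_via_comp (@incl_inj _ _ N U) _ D'D _ (sS i I).
  exact: coord_inj.
by apply: restrict_open => //; exact: dom_open.
Qed.

Definition restrict (N : manifold R m) (U : set N) (oU : open U) (s : mvf N) :
  mvf (open_submanifold oU) := Mvf (restrict_is_mvf oU s).

(* [s'] is [f]-related to [s]; for a diffeomorphism [f] this says that [s'] is the
   pushforward of [s]. *)
Definition is_pushforward (N N' : manifold R m) (f : N -> N')
    (s : mvf N) (s' : mvf N') : Prop :=
  forall (i : atlas_index N) (j : atlas_index N') x, map_dom f (atlas i) (atlas j) x ->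
    s' j (f x) = ext_map (jac f (atlas i) (atlas j) x) (s i x).

(* Smoothness of (p, x) |-> s p x in the product charts of P * N. *)
Definition smooth_family (k : nat) (P : manifold R k) (N : manifold R m)
    (s : P -> mvf N) : Prop :=
  forall (j : atlas_index P) (i : atlas_index N) (I : {set 'I_m}),
    smooth_via (dom (atlas j) `*` dom (atlas i))
      (fun q : P * N => row_mx (atlas j q.1) (atlas i q.2))
      (fun q => s q.1 i q.2 I).

Definition codifferential (N : manifold R m) (d : {linear mvf N -> mvf N}) : Prop :=
  [/\ forall s, homog 0 s -> d s = 0,
      forall n s, homog n.+1 s -> homog n (d s) &
      forall s, d (d s) = 0].

Definition natural_operator (D : forall N : manifold R m, {linear mvf N -> mvf N}) :
    Prop :=
  [/\ forall (N N' : manifold R m) (f : N -> N') s s', diffeomorphism f ->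
        is_pushforward f s s' -> is_pushforward f (D N s) (D N' s'),
      forall (N : manifold R m) (U : set N) (oU : open U) (s : mvf N),
        D (open_submanifold oU) (restrict oU s) = restrict oU (D N s) &
      forall (k : nat) (P : manifold R k) (N : manifold R m) (s : P -> mvf N),
        smooth_family s -> smooth_family (fun p => D N (s p))].

Definition naturally_defined_codifferential (M : manifold R m)
    (d : {linear mvf M -> mvf M}) : Prop :=
  exists D : forall N : manifold R m, {linear mvf N -> mvf N},
    [/\ forall N, codifferential (D N), natural_operator D & D M =1 d].

End MultivectorFields.

(* Main.v *)
Require Import Defs.
From HB Require Import structures.
From mathcomp Require Import all_boot all_order all_algebra.
From mathcomp Require Import all_classical all_reals all_analysis.
From mathcomp Require Import ring lra.

(** Why the theorem holds. Let D be a natural family. In a chart a multivector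
    field is a sum of terms f e_I, so everything comes down to the value at the
    origin of D (f e_I), for f smooth on a box B around 0 in R^m. That this value
    can be computed in B is the content of [Dval_chart] and [Dval_local]: D
    commutes with restriction to open subsets, with charts, and with local
    diffeomorphisms of R^m.

    For I empty the value is 0, since D lowers the degree. Otherwise only the
    components along e_J with one index fewer than I can occur, and some a lies
    in I but not in J. Fix such I, J and a, let c(f) be the component along e_J
    of the value at 0 of D (f e_I), and let rho_t multiply the coordinate x_a by
    t. Three facts force c = 0.

    - Scaling ([coeff_scale]). The map rho_t sends e_I to t e_I and fixes e_J,
      hence c(f o rho_t) = t c(f) for 0 < t <= 1. In particular c kills every
      function that is homogeneous in x_a of a degree other than 1.

    - Reduction to functions linear in x_a ([coeff_eq0]). Hadamard's lemma gives
      f = f o rho_0 + x_a q with q smooth, so c(f) = c(x_a q), and the scaling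
      rule turns this into c(f) = c(x_a (q o rho_t)) for every t in ]0, 1]. The
      right-hand side is continuous in t up to t = 0, because D maps smooth
      families to smooth families ([coeff_continuous]). Hence
      c(f) = c(x_a (q o rho_0)), where q o rho_0 does not depend on x_a.

    - A nonlinear change of coordinates ([coeff_moebius]). For g independent of
      x_a, the local diffeomorphism x_a |-> x_a / (1 - g x_a) is tangent to the
      identity at 0 and carries e_I to (1 + g x_a)^2 e_I. Therefore
      c(1) = c(1 + 2 g x_a + g^2 x_a^2), and by scaling only 2 c(g x_a) = 0
      survives.

    The one operator that passes the scaling test is the coordinate divergence;
    the Moebius map shows that it depends on the coordinates. Conversely, the
    zero operators form a natural family. *)

Set Implicit Arguments.
Unset Strict Implicit.
Unset Printing Implicit Defensive.

Import Order.TTheory GRing.Theory Num.Theory.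
Import numFieldNormedType.Exports.

Local Open Scope classical_set_scope.
Local Open Scope ring_scope.

(** * Continuously differentiable functions *)

Section C1.
Context {R : realType}.

Lemma differentiable_littleo (V W : normedModType R) (f : V -> W)
    (df : {linear V -> W}) x :
  continuous df -> f \o shift x = cst (f x) + df +o_ 0 id -> differentiable f x.
Proof.
by move=> dfc fx; apply/diff_locallyP; rewrite (diff_unique dfc fx).
Qed.

Lemma is_derive_line (V W : normedModType R) (f : V -> W) (p v : V) (t : R) :
  derivable f (p + t *: v) v ->
  is_derive t 1 (fun u : R => f (p + u *: v)) ('D_v f (p + t *: v)).
Proof.
move=> df; have e h : ((fun u => f (p + u *: v)) \o shift t) h%:A =
    (f \o shift (p + t *: v)) (h *: v).
  by rewrite /= [_%:A]mulr1 scalerDl addrCA.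
split; rewrite /derivable /derive.
  by under eq_fun do rewrite e.
by under eq_fun do rewrite e.
Qed.

Lemma MVT_line (V : normedModType R) (f : V -> R) (p v : V) (h : R) :
  (forall t : R, `|t| <= `|h| -> derivable f (p + t *: v) v) ->
  exists2 t, `|t| <= `|h| & f (p + h *: v) - f p = h * 'D_v f (p + t *: v).
Proof.
move=> df.
pose g (u : R) : R := f (p + u *: v).
have dg (t : R) : `|t| <= `|h| -> is_derive t (1 : R) g ('D_v f (p + t *: v)).
  by move=> /df; exact: is_derive_line.
have cg a b : (forall t, t \in `[a, b] -> `|t| <= `|h|) ->
    {within `[a, b], continuous g}.
  move=> ab; apply: derivable_within_continuous => t /ab/dg tab.
  exact: ex_derive.
have [h0|h0] := leP 0 h.
  have le_h t : t \in `[0, h] -> `|t| <= `|h|.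
    by rewrite in_itv/= => /andP[t0 th]; rewrite !ger0_norm.
  have [t /subset_itv_oo_cc/le_h|c cI] := @MVT_segment _ g
      (fun t => 'D_v f (p + t *: v)) _ _ h0 _ (cg _ _ le_h).
    exact: dg.
  rewrite /g scale0r addr0 subr0 => ->.
  by exists c; [exact: le_h|rewrite mulrC].
have le_h t : t \in `[h, 0] -> `|t| <= `|h|.
  by rewrite in_itv/= => /andP[t0 th]; rewrite (ltr0_norm h0) (ler0_norm th) lerN2.
have [t /subset_itv_oo_cc/le_h|c cI] := @MVT_segment _ g
    (fun t => 'D_v f (p + t *: v)) _ _ (ltW h0) _ (cg _ _ le_h).
  exact: dg.
rewrite /g scale0r addr0 sub0r => e.
by exists c; [exact: le_h|rewrite -opprB e mulrN opprK mulrC].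
Qed.

Lemma ball_rowP n (p q : 'rV[R]_n) e :
  ball p e q <-> 0 < e /\ forall b, `|p 0 b - q 0 b| < e.
Proof.
split=> [[e0 pq]|[e0 pq]]; first by split=> // b; exact: pq.
by split=> // i b; rewrite ord1; exact: pq.
Qed.

Lemma coord_le_norm n (h : 'rV[R]_n) b : `|h 0 b| <= `|h|.
Proof.
rewrite [leRHS]/Num.Def.normr /= mx_normrE.
exact: (le_bigmax _ (fun i => `|h i.1 i.2|) (0, b)).
Qed.

(** Walking from p to p + h one coordinate at a time writes the increment of f as
    a sum of one-variable increments, and the mean value theorem evaluates each of
    them at a point that stays within distance |h| of p. *)
Lemma C1_differentiable n (U : set 'rV[R]_n) f p : open U -> Ck 1 U f -> U p ->
  differentiable f p.
Proof.
move=> oU [_ df] Up.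
pose L (h : 'rV[R]_n) : R := \sum_b h 0 b * 'D_(delta_mx 0 b) f p.
have Llin : linear L.
  move=> a h k; rewrite /L scaler_sumr -big_split; apply: eq_bigr => b _ /=.
  by rewrite !mxE mulrDl -scalerAl.
pose df' : {linear 'rV[R]_n -> R} :=
  HB.pack L (GRing.isLinear.Build _ _ _ _ L Llin).
have cL : continuous L.
  move=> h; apply: differentiable_continuous.
  rewrite (_ : L = \sum_b (fun h : 'rV[R]_n => h 0 b * 'D_(delta_mx 0 b) f p)).
    apply: differentiable_sum => b.
    by apply: differentiableM; [exact: differentiable_coord|exact: differentiable_cst].
  by apply/funext => k; rewrite fct_sumE.
apply: (@differentiable_littleo _ _ f df') => //.
apply/eqaddoP => _/posnumP[e].
(* Each of the n steps of the walk costs e' |h|. *)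
pose e' := e%:num / (n%:R + 1).
have e'0 : 0 < e' by rewrite divr_gt0// ltr_wpDl.
have : \forall q \near p, U q /\
    forall b, `|'D_(delta_mx 0 b) f p - 'D_(delta_mx 0 b) f q| < e'.
  apply: filterI; first by apply: open_nbhs_nbhs.
  have nearb b : \forall q \near p,
      `|'D_(delta_mx 0 b) f p - 'D_(delta_mx 0 b) f q| < e'.
    have [_ [cD _]] := df b.
    by have /cvgrPdist_lt := cD _ Up; exact.
  by apply: filterS (filter_forall _ nearb).
move=> /nbhs_ballP[r /= r0 rU].
apply/nbhs_ballP; exists r => //= h; rewrite -ball_normE /ball_/= sub0r normrN => hr.
(* The position after k steps: only the first k coordinates of h are present. *)
pose s k : 'rV[R]_n := \row_b (if (b < k)%N then h 0 b else 0).
have sS (k : 'I_n) : s k.+1 = s k + h 0 k *: delta_mx 0 k.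
  apply/rowP => b; rewrite !mxE ltnS leq_eqVlt.
  have [->|nbk] := eqVneq b k; first by rewrite ltnn !eqxx mulr1 add0r.
  by rewrite -val_eqE in nbk; rewrite (negPf nbk)/= mulr0 addr0.
have near_s (k : 'I_n) t : `|t| <= `|h 0 k| ->
    ball p r (p + s k + t *: delta_mx 0 k).
  move=> th; apply/ball_rowP; split=> // b; rewrite !mxE -addrA opprD addrA.
  rewrite subrr sub0r normrN.
  have [->|nbk] := eqVneq b k.
    rewrite ltnn eqxx/= mulr1 add0r (le_lt_trans th)//.
    exact: le_lt_trans (coord_le_norm _ _) hr.
  rewrite eqxx mulr0 addr0; case: ifP => _; rewrite ?normr0//.
  by rewrite (le_lt_trans (coord_le_norm _ _)).
have s0 : s 0%N = 0 by apply/rowP => b; rewrite !mxE.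
have sn : s n = h by apply/rowP => b; rewrite !mxE ltn_ord.
have step (k : 'I_n) : `|f (p + s k.+1) - f (p + s k) -
    h 0 k * 'D_(delta_mx 0 k) f p| <= e' * `|h|.
  rewrite sS addrA; have [t th|t th ->] := @MVT_line _ f (p + s k) (delta_mx 0 k) (h 0 k).
    have [Uq _] := rU _ (near_s k t th); have [dfk _] := df k; exact: dfk.
  rewrite -mulrBr normrM mulrC ler_pM//; last exact: coord_le_norm.
  by have [_ /(_ k)] := rU _ (near_s k t th); rewrite distrC => /ltW.
rewrite /= [`|_|](_ : _ = `|\sum_(k < n) (f (p + s k.+1) - f (p + s k) -
    h 0 k * 'D_(delta_mx 0 k) f p)|).
  apply: le_trans (ler_norm_sum _ _ _) _.
  apply: le_trans (ler_sum _ (fun k _ => step k)) _.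
  rewrite sumr_const card_ord -mulr_natl mulrA ler_wpM2r// /e'.
  by rewrite mulrCA ler_piMr// ler_pdivrMr ?ltr_wpDl// mul1r lerDl.
rewrite sumrB; congr (`|_|).
rewrite -(big_mkord xpredT (fun k => f (p + s k.+1) - f (p + s k))) telescope_sumr//.
by rewrite sn s0 addr0 -addrA -opprD [p + h]addrC.
Qed.

End C1.

(** * The chain rule and the algebra of smooth functions *)

Section Chain.
Context {R : realType}.

Lemma derive_lineE (V W : normedModType R) (f : V -> W) (p v : V) :
  'D_1 (fun h : R => f (h *: v + p)) 0 = 'D_v f p.
Proof.
rewrite /derive; set g1 := fun h => h^-1 *: _; set g2 := fun h => h^-1 *: _.
suff -> : g1 = g2 by [].
by rewrite funeqE /g1 /g2 => h /=; rewrite addr0 scale0r add0r [_%:A]mulr1.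
Qed.

Lemma is_derive_comp m n (f : 'rV[R]_n -> R) (phi : 'rV[R]_m -> 'rV[R]_n)
    (p v : 'rV[R]_m) :
  differentiable f (phi p) ->
  (forall b, derivable (fun x => phi x 0 b) p v) ->
  is_derive p v (f \o phi)
    (\sum_b 'D_(delta_mx 0 b) f (phi p) * 'D_v (fun x => phi x 0 b) p).
Proof.
move=> df dphi.
have dphi_p : derivable phi p v.
  by apply/derivable_mxP => i b; rewrite (ord1 i); exact: dphi.
pose line (h : R) := phi (h *: v + p).
have line0 : line 0 = phi p by rewrite /line scale0r add0r.
have dline : differentiable line 0.
  by apply/derivable1_diffP; exact: (derivable1P phi p v).1 dphi_p.
have dfl : differentiable f (line 0) by rewrite line0.
have dline_v : 'd line 0 1 = 'D_v phi p by rewrite -deriveE// derive_lineE.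
have dcomp : derivable (f \o line) 0 1.
  by apply/derivable1_diffP; exact: differentiable_comp.
split; first exact: (derivable1P (f \o phi) p v).2 dcomp.
rewrite -(derive_lineE (f \o phi)) -/(f \o line).
rewrite deriveE; last exact: differentiable_comp.
rewrite diff_comp//= dline_v line0 [X in 'd f _ X]row_sum_delta linear_sum.
apply: eq_bigr => b _; rewrite linearZ /= mulrC -deriveE//.
by rewrite derive_mx// !mxE.
Qed.

Variables (n : nat) (U : set 'rV[R]_n).

Lemma Ck_continuous k f p : Ck k U f -> U p -> {for p, continuous f}.
Proof. by case: k => [|k] [cf _]; exact: cf. Qed.

Lemma CkW k f : Ck k.+1 U f -> Ck k U f.
Proof.
elim: k f => [|k IH] f [cf df]; split=> // i.
by have [dfi Cf] := df i; split=> //; exact: IH.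
Qed.

Lemma Ck_cst k c : Ck k U (cst c).
Proof.
case: k => [|k]; (split; first by move=> p _; exact: cst_continuous) => //.
move=> i; split; first by move=> p _; exact: derivable_cst.
rewrite (_ : 'D_(delta_mx 0 i) _ = cst 0); first exact: Ck0.
by apply/funext => p; exact: derive_cst.
Qed.

Lemma is_derive_coord (p : 'rV[R]_n) (i b : 'I_n) :
  is_derive p (delta_mx 0 i) (fun x : 'rV[R]_n => x 0 b) (i == b)%:R.
Proof.
have dI : derivable (id : 'rV[R]_n -> 'rV[R]_n) p (delta_mx 0 i).
  exact: derivable_id.
split; first by have /derivable_mxP := dI; exact.
have := derive_mx dI; rewrite derive_id => /matrixP/(_ 0 b).
by rewrite !mxE eq_sym => <-.
Qed.

Lemma Ck_coord k b : Ck k U (fun x => x 0 b).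
Proof.
case: k => [|k]; (split; first by move=> p _; exact: coord_continuous) => // i.
split=> [p _|]; first by have [] := is_derive_coord p i b.
rewrite (_ : 'D_(delta_mx 0 i) _ = cst ((i == b)%:R : R)); first exact: Ck_cst.
by apply/funext => p; have [_ ->] := is_derive_coord p i b.
Qed.

Hypothesis oU : open U.

Lemma CkD k f g : Ck k U f -> Ck k U g -> Ck k U (fun p => f p + g p).
Proof.
move=> Cf Cg; apply: Ck_eq (Ck_lin 1 oU Cf Cg) => // p _.
by rewrite mul1r.
Qed.

Lemma CkM k f g : Ck k U f -> Ck k U g -> Ck k U (fun p => f p * g p).
Proof.
elim: k f g => [|k IH] f g Cf Cg;
    have cfg : forall p, U p -> {for p, continuous (fun p => f p * g p)};
    try by move=> p Up; apply: (@continuousM R _ f g p);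
      [exact: Ck_continuous Cf Up|exact: Ck_continuous Cg Up].
  by split.
split=> // i.
have [_ /(_ i)[df Cdf]] := Cf; have [_ /(_ i)[dg Cdg]] := Cg.
split=> [p Up|]; first exact: derivableM (df _ Up) (dg _ Up).
apply: Ck_eq (CkD (IH _ _ (CkW Cf) Cdg) (IH _ _ (CkW Cg) Cdf)) => // p Up.
by rewrite [RHS](deriveM (df _ Up) (dg _ Up)).
Qed.

Lemma Ck_sum k (I : finType) (F : I -> 'rV[R]_n -> R) :
  (forall i, Ck k U (F i)) -> Ck k U (fun p => \sum_i F i p).
Proof.
move=> CF; rewrite (_ : (fun _ => _) = \sum_i F i); last first.
  by apply/funext => p; rewrite fct_sumE.
elim/big_ind : _ => [|f g Cf Cg|//]; first exact: Ck_cst.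
exact: CkD.
Qed.

Lemma CkV k f : (forall p, U p -> f p != 0) -> Ck k U f ->
  Ck k U (fun p => (f p)^-1).
Proof.
move=> f0; elim: k f f0 => [|k IH] f f0 Cf.
  by split=> // p Up; apply: continuousV; [exact: f0|exact: Ck_continuous Cf Up].
split=> [p Up|i].
  by apply: continuousV; [exact: f0|exact: Ck_continuous Cf Up].
have [_ /(_ i)[df Cdf]] := Cf.
split=> [p Up|]; first exact: derivableV (f0 _ Up) (df _ Up).
have CV := IH _ f0 (CkW Cf).
apply: Ck_eq (CkM (Ck_cst k (-1)) (CkM (CkM CV CV) Cdf)) => // p Up.
rewrite [RHS](deriveV (f0 _ Up) (df _ Up)).
by rewrite /= mulN1r -[in RHS]exprVn expr2 scaleNr.
Qed.

End Chain.

Lemma continuous_row (R : realType) (T : topologicalType) n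
    (f : T -> 'rV[R]_n) x :
  (forall b, {for x, continuous (fun y => f y 0 b)}) -> {for x, continuous f}.
Proof.
move=> cf A /nbhs_ballP[e /= e0 eA].
have cfb b : \forall y \near x, `|f x 0 b - f y 0 b| < e.
  by have /cvgrPdist_lt := cf b; exact.
apply: filterS (filter_forall _ cfb) => y fxy.
by apply: eA; apply/ball_rowP.
Qed.

(** Partial derivatives alone do not give a chain rule; since they are continuous
    f is differentiable, and the partial derivatives of f o phi are sums of
    products of functions to which the induction hypothesis applies. *)
Lemma Ck_comp (R : realType) m n k (U : set 'rV[R]_m) (V : set 'rV[R]_n) f phi :
  open U -> open V -> (forall p, U p -> V (phi p)) ->
  (forall b, Ck k U (fun p => phi p 0 b)) -> Ck k V f -> Ck k U (f \o phi).
Proof.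
move=> oU oV UV; elim: k f => [|k IH] f Cphi Cf;
    have cf : forall p, U p -> {for p, continuous (f \o phi)}.
- move=> p Up; apply: continuous_comp; last exact: Ck_continuous Cf (UV _ Up).
  by apply: continuous_row => b; exact: Ck_continuous (Cphi b) Up.
- by split.
- move=> p Up; apply: continuous_comp; last exact: Ck_continuous Cf (UV _ Up).
  by apply: continuous_row => b; exact: Ck_continuous (Cphi b) Up.
split=> // i.
have dcomp p : U p -> is_derive p (delta_mx 0 i) (f \o phi)
    (\sum_b 'D_(delta_mx 0 b) f (phi p) *
            'D_(delta_mx 0 i) (fun x => phi x 0 b) p).
  move=> Up; apply: is_derive_comp.
    apply: (C1_differentiable oV) (UV _ Up).
    by elim: (k) Cf => // k' IHk /CkW.
  by move=> b; have [_ /(_ i)[dphi _]] := Cphi b; exact: dphi.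
split=> [p /dcomp[]//|].
apply: (@Ck_eq _ _ _ _ (fun p => \sum_b ('D_(delta_mx 0 b) f \o phi) p *
            'D_(delta_mx 0 i) (fun x => phi x 0 b) p)) => // [p /dcomp[_ ->]//|].
apply: Ck_sum => // b; apply: CkM => //.
  by apply: IH; [move=> b'; exact: CkW|have [_ /(_ b)[]] := Cf].
by have [_ /(_ i)[]] := Cphi b.
Qed.

(** * Hadamard's lemma in one coordinate *)

Section ScaleCoord.
Context {R : realType} {n : nat}.
Implicit Types (x y : 'rV[R]_n) (a b : 'I_n) (t : R).

Definition scale_coord a t x : 'rV[R]_n :=
  \row_b (if b == a then t * x 0 b else x 0 b).

Lemma scale_coordE a t x b :
  scale_coord a t x 0 b = (if b == a then t else 1) * x 0 b.
Proof. by rewrite mxE; case: ifP => _; rewrite ?mul1r. Qed.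

Lemma scale_coord1 a x : scale_coord a 1 x = x.
Proof. by apply/rowP => b; rewrite scale_coordE if_same mul1r. Qed.

Lemma scale_coord_line a t b h x : scale_coord a t (x + h *: delta_mx 0 b) =
  scale_coord a t x + h *: ((if b == a then t else 1) *: delta_mx 0 b).
Proof.
apply/rowP => c; rewrite !(scale_coordE, mxE) mulrDr eqxx /=.
have [->|_] := eqVneq c b; first by rewrite !mulr1 [h * _]mulrC.
by rewrite !mulr0.
Qed.

Lemma scale_coord_continuous a t x :
  {for (t, x), continuous (fun z : R * 'rV[R]_n => scale_coord a z.1 z.2)}.
Proof.
apply: continuous_row => b; rewrite /prop_for /continuous_at.
under eq_fun do rewrite scale_coordE; rewrite scale_coordE.
apply: (@continuousM R _ (fun z : R * 'rV[R]_n => if b == a then z.1 else 1)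
  (fun z => z.2 0 b) (t, x)).
  by case: (b == a); [exact: cvg_fst|exact: cvg_cst].
apply: (@continuous_comp _ _ _ (@snd R 'rV[R]_n) (fun y => y 0 b)).
  exact: cvg_snd.
exact: coord_continuous.
Qed.

Lemma scale_coord0 a t : scale_coord a t 0 = 0.
Proof. by apply/rowP => b; rewrite scale_coordE !mxE mulr0. Qed.

Lemma scale_coordM a s t x :
  scale_coord a s (scale_coord a t x) = scale_coord a (s * t) x.
Proof. by apply/rowP => b; rewrite !mxE; case: (b == a); rewrite ?mulrA. Qed.

Lemma scale_coord_ball a t r x : `|t| <= 1 -> ball 0 r x ->
  ball 0 r (scale_coord a t x).
Proof.
move=> t1 /ball_rowP[r0 Bx]; apply/ball_rowP; split=> // b.
have := Bx b; rewrite !mxE !sub0r !normrN; case: ifP => // _ xb.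
by rewrite normrM (le_lt_trans _ xb)// ler_piMl.
Qed.

End ScaleCoord.

Section Hadamard.
Context {R : realType} {n : nat}.
Variables (U : set 'rV[R]_n) (a : 'I_n).
Hypothesis oU : open U.
Hypothesis starU : forall x t, U x -> t \in `[0, 1] -> U (scale_coord a t x).
Notation mu := (@lebesgue_measure R).
Notation rho := (scale_coord a).

(** For j = 0 and G the partial derivative of f in the direction a, this is
    Hadamard's quotient (f - f o rho_0) / x_a. The weight t^j makes the family of
    all these means stable under partial derivatives, which is how smoothness is
    obtained. *)
Definition radial_mean (j : nat) (G : 'rV[R]_n -> R) x : R :=
  \int[mu]_(t in `[0, 1]) (t ^+ j * G (rho t x)).

Let G_continuous G x t : Ck 0 U G -> U x -> t \in `[0, 1] ->
  {for (t, x), continuous (fun z : R * 'rV[R]_n => G (rho z.1 z.2))}.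
Proof.
move=> CG Ux t01.
apply: (@continuous_comp _ _ _ (fun z : R * 'rV[R]_n => rho z.1 z.2) G).
  exact: scale_coord_continuous.
exact: Ck_continuous CG (starU Ux t01).
Qed.

Let integrable_continuous (f : R -> R) :
  (forall t, t \in `[0, 1] -> {for t, continuous f}) ->
  mu.-integrable `[0, 1] (EFin \o f).
Proof.
move=> cf; apply: continuous_compact_integrable; first exact: segment_compact.
by apply: continuous_in_subspaceT => t /set_mem /cf.
Qed.

Let G_continuous_t G x t : Ck 0 U G -> U x -> t \in `[0, 1] ->
  {for t, continuous (fun t => G (rho t x))}.
Proof.
move=> CG Ux t01.
apply: (@continuous_comp _ _ _ (fun t : R => (t, x)) (fun z => G (rho z.1 z.2))).
  move=> P [[A B] /= [tA xB] AB]; apply: filterS tA => s As.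
  by apply: (AB (s, x)); split => //=; exact: nbhs_singleton xB.
exact: G_continuous.
Qed.

Let mean_continuous_t j G x (t : R) : Ck 0 U G -> U x -> t \in `[0, 1] ->
  {for t, continuous (fun t : R => t ^+ j * G (rho t x))}.
Proof.
move=> CG Ux t01.
apply: (@continuousM R _ (fun t : R => t ^+ j) (fun t => G (rho t x))).
  exact: exprn_continuous.
exact: G_continuous_t.
Qed.

(** Compactness of the interval makes the estimate uniform in t. *)
Let G_near G x e : Ck 0 U G -> U x -> 0 < e ->
  \forall y \near x, U y /\
    forall t, t \in `[0, 1] -> `|G (rho t x) - G (rho t y)| < e.
Proof.
move=> CG Ux e0; apply: filterI; first by apply: open_nbhs_nbhs.
have /compact_near_coveringP/near_covering_withinP := @segment_compact R 0 1.
move=> /(_ _ (nbhs x) (fun y t => `|G (rho t x) - G (rho t y)| < e)).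
apply => t t01.
have e20 : 0 < e / 2 by rewrite divr_gt0.
have /cvgrPdist_lt/(_ _ e20)[[A B] [/= tA xB] AB] := G_continuous CG Ux t01.
have /cvgrPdist_lt/(_ _ e20) tC := G_continuous_t CG Ux t01.
pose C := [set s | `|G (rho t x) - G (rho s x)| < e / 2].
exists (A `&` C, B) => /=; first by split=> //; exact: filterI.
move=> [s y] /= [[As Cs] By] _.
rewrite -(subrKA (G (rho t x))) (le_lt_trans (ler_normD _ _))//.
rewrite (splitr e) ltrD//; first by rewrite distrC.
exact: (AB (s, y)).
Qed.

Let integrable_mean j G x : Ck 0 U G -> U x ->
  mu.-integrable `[0, 1] (EFin \o (fun t => t ^+ j * G (rho t x))).
Proof.
by move=> CG Ux; apply: integrable_continuous => t t01; exact: mean_continuous_t.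
Qed.

Let expr01_le1 (t : R) j : t \in `[0, 1] -> `|t ^+ j| <= 1.
Proof.
rewrite in_itv/= => /andP[t0 t1].
by rewrite normrX ger0_norm// exprn_ile1.
Qed.

Let mean_continuous j G x : Ck 0 U G -> U x ->
  {for x, continuous (radial_mean j G)}.
Proof.
move=> CG Ux; apply/(@cvgrPdist_le _ _ _ (nbhs x)) => e e0.
apply: filterS (G_near CG Ux e0) => y [Uy Gy].
rewrite /radial_mean -RintegralB//; try exact: integrable_mean.
have iB : mu.-integrable `[0, 1] (EFin \o (fun t => t ^+ j * G (rho t x) -
    t ^+ j * G (rho t y))).
  apply: integrable_continuous => t t01.
  apply: (@continuousB _ _ _ (fun t : R => t ^+ j * G (rho t x))
    (fun t => t ^+ j * G (rho t y))); exact: mean_continuous_t.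
apply: le_trans (le_normr_Rintegral _ iB) _ => //.
apply: (@le_trans _ _ (\int[mu]_(t in `[0, 1]) e)); last first.
  rewrite Rintegral_cst//.
  have mu01 : mu `[0, 1] = 1%E.
    by rewrite lebesgue_measure_itv/= lte_fin ltr01 sube0.
  by rewrite [leLHS](congr1 (fun z => e * fine z) mu01) mulr1.
apply: le_Rintegral => //.
- apply: integrable_continuous => t t01.
  apply: continuous_comp; last exact: norm_continuous.
  apply: (@continuousB _ _ _ (fun t : R => t ^+ j * G (rho t x))
    (fun t => t ^+ j * G (rho t y))); exact: mean_continuous_t.
- by apply: integrable_continuous => t _; exact: cst_continuous.
move=> t t01; rewrite -mulrBr normrM -[leRHS]mul1r ler_pM//; last exact/ltW/Gy.
exact: expr01_le1.
Qed.

Let is_derive_mean j G x (b : 'I_n) (t h : R) : Ck 1 U G -> t \in `[0, 1] ->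
  U (h *: delta_mx 0 b + x) ->
  is_derive h 1 (fun h : R => t ^+ j * G (rho t (h *: delta_mx 0 b + x)))
    (t ^+ (j + (b == a)) *
      'D_(delta_mx 0 b) G (rho t (h *: delta_mx 0 b + x))).
Proof.
move=> CG t01; rewrite addrC => Uxh; set c := if b == a then t else 1.
have rhoE h' : rho t (h' *: delta_mx 0 b + x) =
    rho t x + h' *: (c *: delta_mx 0 b) by rewrite addrC scale_coord_line.
have dG : differentiable G (rho t x + h *: (c *: delta_mx 0 b)).
  by rewrite -scale_coord_line; apply: C1_differentiable CG (starU Uxh t01).
under eq_fun do rewrite rhoE.
have dline := is_derive_line (@diff_derivable _ _ _ G _ (c *: delta_mx 0 b) dG).
apply: is_derive_eq (@is_deriveZ _ _ _ _ (t ^+ j) _ _ _ dline) _.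
rewrite !scale_coord_line deriveE// linearZ/= -deriveE// /c.
by case: (b == a); rewrite ?addn1 ?addn0 ?exprSr -?mulrA ?scale1r.
Qed.

(** Differentiation under the integral sign. Near x the integrands are dominated
    by |D_b G (rho t x)| + 1, thanks to the uniform estimate [G_near]. *)
Let derive_mean j G x (b : 'I_n) : Ck 1 U G -> U x ->
  is_derive x (delta_mx 0 b) (radial_mean j G)
    (radial_mean (j + (b == a)) ('D_(delta_mx 0 b) G) x).
Proof.
move=> CG Ux.
have [_ /(_ b)[_ CDG]] := CG.
have cline : (h *: delta_mx 0 b + x) @[h --> (0 : R)] --> x.
  have : (h *: delta_mx 0 b + x) @[h --> (0 : R)] --> 0 *: delta_mx 0 b + x.
    by apply: cvgD; [exact: scalel_continuous|exact: cvg_cst].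
  by rewrite scale0r add0r.
have /nbhs_ballP[r /= r0 rU] := cline _ (G_near CDG Ux ltr01).
have inI h : `]- r, r[%classic h -> ball 0 r h.
  by rewrite /= in_itv/= -ball_normE /ball_/= sub0r normrN ltr_norml.
pose f (h t : R) := t ^+ j * G (rho t (h *: delta_mx 0 b + x)).
pose g (t : R) := `|'D_(delta_mx 0 b) G (rho t x)| + 1.
have I0 : `]- r, r[%classic 0 by rewrite /= in_itv/= oppr_lt0 r0.
have CG0 : Ck 0 U G by exact: CkW.
have intf h : `]- r, r[%classic h -> mu.-integrable `[0, 1] (EFin \o f h).
  by move=> /inI/rU[Uh _]; exact: integrable_mean.
have derf h t : `]- r, r[%classic h -> `[0, 1]%classic t ->
    is_derive h 1 (f ^~ t) (t ^+ (j + (b == a)) *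
      'D_(delta_mx 0 b) G (rho t (h *: delta_mx 0 b + x))).
  by move=> /inI/rU[Uh _] t01; exact: is_derive_mean.
have d1f h t : `]- r, r[%classic h -> `[0, 1]%classic t ->
    partial1of2 f h t = t ^+ (j + (b == a)) *
      'D_(delta_mx 0 b) G (rho t (h *: delta_mx 0 b + x)).
  by move=> Ih t01; rewrite partial1of2E; have [_ ->] := derf _ _ Ih t01.
have df h t : `]- r, r[%classic h -> `[0, 1]%classic t ->
    derivable (f ^~ t) h 1.
  by move=> Ih t01; have [] := derf _ _ Ih t01.
have g0 t : 0 <= g t by rewrite addr_ge0.
have intg : mu.-integrable `[0, 1] (EFin \o g).
  apply: integrable_continuous => t t01.
  apply: (@continuousD R R R (fun t : R => `|'D_(delta_mx 0 b) G (rho t x)|)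
      (cst 1)).
    apply: (@continuous_comp R R R (fun t : R => 'D_(delta_mx 0 b) G (rho t x))
      Num.norm); last exact: norm_continuous.
    exact: G_continuous_t CDG Ux t01.
  exact: cst_continuous.
have fg h t : `]- r, r[%classic h -> `[0, 1]%classic t ->
    `|partial1of2 f h t| <= g t.
  move=> Ih t01; rewrite d1f// normrM -[g t]mul1r ler_pM//.
    exact: expr01_le1.
  have [_ /(_ t t01)/ltW] := rU _ (inI _ Ih).
  rewrite distrC => /(le_trans (lerB_dist _ _)).
  by rewrite lerBlDl.
have derF := @derivable_under_integral R _ _ mu f _ (measurable_itv _) _ _ _
  I0 intf df g g0 intg fg.
have valF := @differentiation_under_integral R _ _ mu f _ (measurable_itv _) _ _ _
  I0 intf df g g0 intg fg.
split; first exact: (derivable1P (radial_mean j G) x (delta_mx 0 b)).2.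
rewrite -derive_lineE -derive1E [LHS]valF.
apply: eq_Rintegral => t /set_mem t01.
by rewrite d1f// scale0r add0r.
Qed.

Lemma smooth_radial_mean k j G : (forall k, Ck k U G) -> Ck k U (radial_mean j G).
Proof.
elim: k j G => [|k IH] j G CG; split=> //;
  try by move=> x Ux; exact: mean_continuous (CG 0%N) Ux.
move=> b; split=> [x Ux|]; first by have [] := derive_mean j b (CG 1%N) Ux.
apply: Ck_eq (IH (j + (b == a))%N ('D_(delta_mx 0 b) G) _) => //.
  by move=> x Ux; have [_ ->] := derive_mean j b (CG 1%N) Ux.
by move=> k'; have [_ /(_ b)[]] := CG k'.+1.
Qed.

(** The fundamental theorem of calculus along the segment from rho 0 x to x. *)
Lemma Hadamard G x : Ck 1 U G -> U x ->
  G x = G (rho 0 x) + x 0 a * radial_mean 0 ('D_(delta_mx 0 a) G) x.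
Proof.
move=> CG Ux.
have [_ /(_ a)[_ CDG]] := CG.
have rhoE t : rho t x = rho 0 x + t *: (x 0 a *: delta_mx 0 a).
  apply/rowP => b; rewrite !(scale_coordE, mxE) eqxx /=.
  by have [->|_] := eqVneq b a; rewrite ?mulr1 ?mul0r ?add0r ?mulr0 ?addr0.
have dF (t : R) : t \in `[0, 1] -> is_derive t (1 : R) (fun t : R => G (rho t x))
    (x 0 a * 'D_(delta_mx 0 a) G (rho t x)).
  move=> t01; have dG : differentiable G (rho t x).
    exact: C1_differentiable CG (starU Ux t01).
  have dG' : differentiable G (rho 0 x + t *: (x 0 a *: delta_mx 0 a)).
    by rewrite -rhoE.
  have dl := @diff_derivable _ _ _ G _ (x 0 a *: delta_mx 0 a) dG'.
  under eq_fun do rewrite rhoE.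
  apply: is_derive_eq (is_derive_line dl) _.
  by rewrite -(rhoE t) (deriveE _ dG) linearZ/= -(deriveE _ dG).
have cF (t : R) : t \in `[0, 1] -> {for t, continuous (fun t : R => G (rho t x))}.
  by move=> t01; apply: G_continuous_t; first exact: CkW.
have cf (t : R) : t \in `[0, 1] -> {for t, continuous
    (fun t : R => x 0 a * 'D_(delta_mx 0 a) G (rho t x))}.
  move=> t01; apply: (@continuousM R _ (cst (x 0 a))
    (fun t : R => 'D_(delta_mx 0 a) G (rho t x))); first exact: cst_continuous.
  exact: G_continuous_t CDG Ux t01.
have := @continuous_FTC2 R (fun t => x 0 a * 'D_(delta_mx 0 a) G (rho t x))
  (fun t => G (rho t x)) 0 1 ltr01.
rewrite scale_coord1 => FTC.
rewrite -[radial_mean _ _ _]/(\int[mu]_(t in `[0, 1]) _).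
rewrite -RintegralZl//; last exact: (integrable_mean 0 CDG Ux).
rewrite [X in _ + X](_ : _ = G x - G (rho 0 x)); first by rewrite addrC subrK.
rewrite -[RHS]/(fine ((G x)%:E - (G (rho 0 x))%:E)) -FTC.
- by congr fine; apply: eq_integral => t _; rewrite expr0 mul1r.
- by apply: continuous_in_subspaceT => t /set_mem; exact: cf.
- split.
  + by move=> t /subset_itv_oo_cc/dF[].
  + by have := cF 0; rewrite in_itv/= lexx ler01 => /(_ isT)/cvg_at_right_filter.
  + by have := cF 1; rewrite in_itv/= lexx ler01 => /(_ isT)/cvg_at_left_filter.
- by move=> t /subset_itv_oo_cc/dF[_ <-]; rewrite derive1E.
Qed.

End Hadamard.

(** * Minors of matrices that differ from the identity in one column *)

Section Minors.
Context {R : realType} {m : nat}.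
Implicit Types (A : 'M[R]_m) (I J : {set 'I_m}) (a : 'I_m).

Lemma minor_zero_col A I J b : b \in J -> (forall i, i \in I -> A i b = 0) ->
  minor A I J = 0.
Proof.
move=> Jb A0; rewrite /minor; case: eqP => // IJ.
pose b0 := cast_ord (esym IJ) (enum_rank_in Jb b).
rewrite (expand_det_col _ b0) big1// => i _; rewrite mxE /b0 cast_ordKV.
by rewrite enum_rankK_in// A0 ?mul0r//; exact: enum_valP.
Qed.

(** Two distinct sets of the same size leave some b in J outside I, and the
    column b of the submatrix vanishes. *)
Lemma minor_col_neq A I J : I != J ->
  (forall b, b \notin I -> forall i, i \in I -> A i b = 0) -> minor A I J = 0.
Proof.
move=> IJ A0; have [JI|/subsetPn[b Jb Ib]] := boolP (J \subset I); last first.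
  exact: minor_zero_col Jb (A0 b Ib).
rewrite /minor; case: eqP => // cIJ; case/eqP: IJ; apply/esym/eqP.
by rewrite eqEcard JI cIJ /=.
Qed.

Lemma minor_diag_block A I :
  minor A I I = \det (\matrix_(i < #|I|, j < #|I|) A (enum_val i) (enum_val j)).
Proof.
rewrite /minor; case: eqP => // II; congr (\det _).
by apply/matrixP => i j; rewrite !mxE cast_ord_id.
Qed.

(** When J = I, the row a of the submatrix has A a a as its only nonzero entry,
    and deleting that row and the column a leaves an identity matrix. *)
Lemma minor_col A a I J : (forall i j, j != a -> A i j = (i == j)%:R) ->
  a \in I -> minor A I J = if J == I then A a a else 0.
Proof.
move=> AE Ia; have [->|JI] := eqVneq J I; last first.
  apply: minor_col_neq; first by rewrite eq_sym.
  move=> b Ib i Ii; rewrite AE; last by apply: contraNneq Ib => ->.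
  by case: eqP Ib => // <-; rewrite Ii.
rewrite minor_diag_block (expand_det_row _ (enum_rank_in Ia a)).
rewrite (bigD1 (enum_rank_in Ia a))//= big1 ?addr0 => [|j ja].
  rewrite mxE enum_rankK_in// /cofactor -signr_odd oddD addbb expr0 mul1r.
  rewrite (_ : row' _ _ = 1%:M) ?det1 ?mulr1//.
  apply/matrixP => i j; rewrite !mxE AE.
    by rewrite (inj_eq enum_val_inj) (inj_eq lift_inj).
  rewrite -[X in _ != X](enum_rankK_in Ia Ia) (inj_eq enum_val_inj).
  by rewrite eq_sym neq_lift.
have ja' : enum_val j != a.
  by rewrite -[X in _ != X](enum_rankK_in Ia Ia) (inj_eq enum_val_inj).
by rewrite mxE enum_rankK_in// AE// eq_sym (negPf ja') mul0r.
Qed.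

Lemma minor_diag A a I J : (forall i j, i != j -> A i j = 0) ->
  (forall i, i != a -> A i i = 1) ->
  minor A I J = if J == I then if a \in I then A a a else 1 else 0.
Proof.
move=> A0 A1; have [Ia|Ia] := boolP (a \in I).
  apply: minor_col => // i j ja; have [->|ij] := eqVneq i j; first exact: A1.
  exact: A0.
have [->|JI] := eqVneq J I; last first.
  apply: minor_col_neq; first by rewrite eq_sym.
  by move=> b Ib i Ii; rewrite A0//; apply: contraNneq Ib => <-.
rewrite minor_diag_block (_ : \matrix_(i, j) _ = 1%:M) ?det1//.
apply/matrixP => i j; rewrite !mxE; have [->|ij] := eqVneq i j.
  by rewrite A1//; apply: contraNneq Ia => <-; exact: enum_valP.
by rewrite A0// (inj_eq enum_val_inj).
Qed.

Lemma ext_map_diag A a (v : ext R m) J : (forall i j, i != j -> A i j = 0) ->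
  (forall i, i != a -> A i i = 1) ->
  ext_map A v J = (if a \in J then A a a else 1) * v J.
Proof.
move=> A0 A1; rewrite ffunE (bigD1 J)//= (minor_diag _ _ A0 A1) eqxx.
rewrite big1 ?addr0// => I IJ.
by rewrite (minor_diag _ _ A0 A1) eq_sym (negPf IJ) mul0r.
Qed.

Lemma ext_map1 (v : ext R m) : ext_map 1%:M v = v.
Proof.
apply/ffunP => J; rewrite ffunE (bigD1 J)//= big1 ?addr0 => [|I IJ].
  rewrite minor_diag_block (_ : \matrix_(i, j) _ = 1%:M) ?det1 ?mul1r//.
  by apply/matrixP => i j; rewrite !mxE (inj_eq enum_val_inj).
rewrite minor_col_neq ?mul0r// => b Ib i Ii.
by rewrite mxE; case: eqP Ib => // <-; rewrite Ii.
Qed.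

(** The multivector c e_I. *)
Definition monomial (I : {set 'I_m}) (c : R) : ext R m :=
  [ffun J => if J == I then c else 0].

Lemma ext_map_monomial A a I c : (forall i j, j != a -> A i j = (i == j)%:R) ->
  a \in I -> ext_map A (monomial I c) = monomial I (A a a * c).
Proof.
move=> AE Ia; apply/ffunP => J; rewrite !ffunE (bigD1 I)//= big1 ?addr0.
  by rewrite (minor_col _ AE Ia) ffunE eqxx; case: eqP; rewrite ?mul0r.
by move=> K KI; rewrite ffunE (negPf KI) mulr0.
Qed.

End Minors.

(** * Open subsets of R^m as manifolds *)

Section Local.
Context {R : realType}.

Definition smooth n (U : set 'rV[R]_n) (f : 'rV[R]_n -> R) := forall k, Ck k U f.

Lemma smooth_viaP (T : Type) n (D : set T) (c : T -> 'rV[R]_n) f F :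
  set_inj D c -> open (c @` D) -> (forall x, D x -> f x = F (c x)) ->
  smooth (c @` D) F -> smooth_via D c f.
Proof.
move=> cI oD fF sF k; apply: Ck_eq (sF k) => // _ [x Dx <-].
by rewrite local_repE// fF.
Qed.

(** The Jacobian of f is that of any expression phi of f in the charts, even of
    one that is given by a formula on the whole of R^m. *)
Lemma jacE (T T' : topologicalType) m m' (f : T -> T') (c : chart R T m)
    (c' : chart R T' m') (phi : 'rV[R]_m -> 'rV[R]_m') x :
  open (map_dom f c c') -> map_dom f c c' x ->
  (forall y, map_dom f c c' y -> c' (f y) = phi (c y)) ->
  jac f c c' x = \matrix_(a, b)
    'D_(delta_mx 0 a) (fun p => phi p 0 b) (c x).
Proof.
move=> oD Dx fphi; apply/matrixP => a b; rewrite !mxE; apply: near_eq_derive.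
have : open_nbhs (c x) (c @` map_dom f c c').
  split; last by exists x.
  by apply: coord_open => // y [].
move=> /open_nbhs_nbhs; apply: filterS => _ [y Dy <-].
by rewrite local_repE ?fphi//; exact: map_dom_inj.
Qed.

End Local.

Section Model.
Context {R : realType} {m : nat}.

Lemma rV_separable : separable_space 'rV[R]_m.
Proof.
exists (range (fun v : 'rV[rat]_m => map_mx ratr v)).
  exact: sub_countable (card_image_le _ _) (countableP _).
move=> O [x Ox] oO.
have [e /= e0 eO] : nbhs_ball x O.
  by apply/nbhs_ballP/open_nbhs_nbhs.
(* A rational point of the ball, chosen coordinate by coordinate. *)
have /choice[q xq] (b : 'I_m) : exists q : rat, `|x 0 b - ratr q| < e.
  have ne : ball (x 0 b) e !=set0 by exists (x 0 b); exact: ballxx.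
  have [y [xy [q _ qy]]] := dense_rat ne (ball_open _ _).
  by exists q; rewrite qy; exact: xy.
exists (map_mx ratr (\row_b q b)); split; last by exists (\row_b q b).
by apply: eO; apply/ball_rowP; split=> // b; rewrite !mxE.
Qed.

Let id_open_map (V : set 'rV[R]_m) : open V -> V `<=` setT -> open (id @` V).
Proof. by rewrite image_id. Qed.

Definition rV_chart : chart R 'rV[R]_m m :=
  Chart openT (in2W (@inj_id _)) (fun x _ => @cvg_id _ _) id_open_map.

Let rV_cover (x : 'rV[R]_m) : exists i : unit, dom rV_chart x.
Proof. by exists tt. Qed.

Let rV_compat (i j : unit) : smooth_in id rV_chart rV_chart.
Proof.
move=> b; apply: (@smooth_viaP _ _ _ _ _ _ (fun x => x 0 b)) => //.
- rewrite (_ : [set _ | _ in _] = setT); first exact: openT.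
  by apply/seteqP; split=> // p _; exists p.
- by move=> k; exact: Ck_coord.
Qed.

Definition rV_manifold : manifold R m :=
  Manifold rV_cover rV_compat (@norm_hausdorff _ _) rV_separable.

Variables (V : set 'rV[R]_m) (oV : open V).

Definition open_domain : manifold R m := @open_submanifold R m rV_manifold V oV.

Definition domain_pt (p : 'rV[R]_m) (Vp : V p) : open_domain := exist _ p (mem_set Vp).

Lemma open_domain_image (i : atlas_index open_domain) : atlas i @` dom (atlas i) = V.
Proof.
apply/seteqP; split=> [_ [x _ <-]|p Vp]; first exact: set_valP.
by exists (domain_pt Vp).
Qed.

(** The multivector field with components F. The default value 0 of [insubd],
    taken when F is not smooth on V, avoids carrying smoothness proofs in terms. *)
Definition mvf_of (F : 'rV[R]_m -> ext R m) : mvf open_domain :=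
  insubd 0 (fun (i : atlas_index open_domain) (x : open_domain) => F (set_val x)).

Lemma mvf_of_is_mvf (F : 'rV[R]_m -> ext R m) : (forall I, smooth V (fun p => F p I)) ->
  (fun (i : atlas_index open_domain) (x : open_domain) => F (set_val x)) \in
  @is_mvf R m open_domain.
Proof.
move=> sF; apply/asboolP; split.
- by move=> i x /(_ I).
- move=> [] [] x _; rewrite (@jacE _ _ _ _ _ _ _ _ id) => //; last first.
    exact: map_dom_id_open.
  rewrite (_ : \matrix_(a, b) _ = 1%:M) ?ext_map1//.
  apply/matrixP => a b; rewrite !mxE.
  by have [_ ->] := is_derive_coord (atlas (tt : atlas_index open_domain) x) a b.
- move=> i I; apply: (@smooth_viaP _ _ _ _ _ _ (fun p => F p I)) => //.
  + by rewrite open_domain_image.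
  + by rewrite open_domain_image.
Qed.

Lemma mvf_ofE (F : 'rV[R]_m -> ext R m) (i : atlas_index open_domain) (x : open_domain) :
  (forall I, smooth V (fun p => F p I)) -> mvf_of F i x = F (set_val x).
Proof.
by move=> /mvf_of_is_mvf FP; rewrite -[LHS]/(val (mvf_of F) i x) insubdK.
Qed.

Lemma mvf_linE (N : manifold R m) c (s t : mvf N) i x :
  (c *: s + t) i x = c *: s i x + t i x.
Proof. by []. Qed.

Lemma mvf_of_lin a (F G : 'rV[R]_m -> ext R m) :
  (forall I, smooth V (fun p => F p I)) -> (forall I, smooth V (fun p => G p I)) ->
  mvf_of (fun p => a *: F p + G p) = a *: mvf_of F + mvf_of G.
Proof.
move=> sF sG; apply: val_inj; apply/funext => i; apply/funext => x.
rewrite [LHS]mvf_ofE => [|I k]; first by rewrite [RHS]/= !fctE !mvf_ofE.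
apply: Ck_eq (Ck_lin a oV (sF I k) (sG I k)) => // p _.
by rewrite !ffunE.
Qed.

End Model.

Section SmoothMap.
Context {R : realType} {m : nat}.

(** In any other pair of charts, f reads as a transition map, followed by phi,
    followed by another transition map. *)
Lemma smooth_map_chart (N N' : manifold R m) (i : atlas_index N)
    (j : atlas_index N') (f : N -> N') (phi : 'rV[R]_m -> 'rV[R]_m) :
  (forall x, dom (atlas i) x) -> (forall y, dom (atlas j) y) ->
  (forall x, atlas j (f x) = phi (atlas i x)) ->
  (forall b, smooth (atlas i @` setT) (fun p => phi p 0 b)) ->
  smooth_map f.
Proof.
move=> di dj fphi sphi.
have oI : open (atlas i @` setT) by apply: coord_open => //; exact: openT.
have cphi p : (atlas i @` setT) p -> {for p, continuous phi}.
  by move=> Ip; apply: continuous_row => b; exact: (Ck_continuous (sphi b 0%N)).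
have cf : continuous f.
  move=> x A; rewrite nbhsE => -[B [oB Bx] BA].
  have oJ : open (atlas j @` B) by apply: coord_open.
  have nB : nbhs (phi (atlas i x)) (atlas j @` B).
    by apply: open_nbhs_nbhs; split=> //; exists (f x).
  have cg : {for x, continuous (phi \o atlas i)}.
    apply: continuous_comp; first exact: Defs.coord_continuous.
    by apply: cphi; exists x.
  have nx : \forall y \near x, (atlas j @` B) (phi (atlas i y)) by exact: cg.
  rewrite nbhs_simpl /=.
  apply: filterS nx => y /= [z Bz]; rewrite -fphi => zy.
  by apply: BA; rewrite -(@coord_inj _ _ _ (atlas j) z (f y)) ?inE.
split=> // i' j' b.
set D := map_dom f (atlas i') (atlas j').
have oD : open D.
  apply: openI; first exact: dom_open.
  by apply: open_comp => [x _|]; [exact: cf|exact: dom_open].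
(* The two transition maps: sigma from chart i' to chart i, and tau the coordinate
   b of the one from chart j to chart j'. *)
pose sigma p := \row_a local_rep (map_dom id (atlas i') (atlas i)) (atlas i')
  (fun x => atlas i x 0 a) p.
pose tau := local_rep (map_dom id (atlas j) (atlas j')) (atlas j)
  (fun y => atlas j' y 0 b).
have sigmaE x : D x -> sigma (atlas i' x) = atlas i x.
  move=> [xi' _]; apply/rowP => a; rewrite mxE local_repE//; first exact: map_dom_inj.
  by split=> //; exact: di.
have oU : open (atlas i' @` D) by apply: coord_open => // ? [].
apply: (@smooth_viaP _ _ _ _ _ _ (tau \o (phi \o sigma))) => //.
- exact: map_dom_inj.
- move=> x Dx; have [_ xj'] := Dx.
  rewrite /= sigmaE// -fphi /tau local_repE//; exact: map_dom_inj.
move=> k; apply: (@Ck_comp _ _ _ _ _ (atlas j @` map_dom id (atlas j) (atlas j'))) => //.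
- by apply: coord_open; [exact: map_dom_id_open|move=> y []].
- move=> _ [x Dx <-]; rewrite /= sigmaE// -fphi.
  by exists (f x) => //; case: Dx => _ ?; split=> //; exact: dj.
- move=> c; apply: (@Ck_comp _ _ _ _ _ (atlas i @` setT) (fun p => phi p 0 c)) => //.
  + by move=> _ [x Dx <-]; rewrite sigmaE//; exists x.
  + move=> a; apply: Ck_eq (Ck_sub _ (atlas_compat i' i a k)) => //.
      by move=> p _; rewrite mxE.
    by move=> _ [x [xi' _] <-]; exists x => //; split=> //; exact: di.
  + exact: sphi.
exact: atlas_compat.
Qed.

End SmoothMap.

(** * Natural operators in coordinates *)

Section Naturality.
Context {R : realType} {m : nat}.
Variable D : forall N : manifold R m, {linear mvf N -> mvf N}.
Hypothesis natD : natural_operator D.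

(** The value at p of D applied to the field with components F, with a harmless
    default outside V so that p need not carry a membership proof. *)
Definition Dval (V : set 'rV[R]_m) (oV : open V) (F : 'rV[R]_m -> ext R m)
    (p : 'rV[R]_m) : ext R m :=
  if pselect (V p) is left Vp
  then D (open_domain oV) (mvf_of oV F) tt (domain_pt oV Vp) else 0.

Lemma DvalE V (oV : open V) F (i : atlas_index (open_domain oV)) (x : open_domain oV) :
  Dval oV F (set_val x) = D (open_domain oV) (mvf_of oV F) i x.
Proof.
case: i; rewrite /Dval; case: pselect => [Vx|]; last by case; exact: set_valP.
by congr (D _ _ _ _); exact: val_inj.
Qed.

Definition jmx (phi : 'rV[R]_m -> 'rV[R]_m) p : 'M[R]_m :=
  \matrix_(a, b) 'D_(delta_mx 0 a) (fun q => phi q 0 b) p.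

Lemma jmx_id p : jmx id p = 1%:M.
Proof.
by apply/matrixP => a b; rewrite !mxE; have [_ ->] := is_derive_coord p a b.
Qed.

(** The chart i is a diffeomorphism from an open submanifold of N onto V. As V has
    a single chart, being the pushforward of s under it is the transformation law
    of the components of s. *)
Lemma Dval_chart (N : manifold R m) (i : atlas_index N) (V : set 'rV[R]_m)
    (oV : open V) (s : mvf N) (F : 'rV[R]_m -> ext R m) x :
  V `<=` atlas i @` dom (atlas i) ->
  (forall I, smooth V (fun p => F p I)) ->
  (forall x, dom (atlas i) x -> V (atlas i x) -> F (atlas i x) = s i x) ->
  dom (atlas i) x -> V (atlas i x) -> D N s i x = Dval oV F (atlas i x).
Proof.
move=> VD sF Fs dx Vx.
pose U := dom (atlas i) `&` atlas i @^-1` V.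
have oU : open U.
  rewrite openE => y [dy Vy]; apply: filterI.
    by apply: open_nbhs_nbhs; split=> //; exact: dom_open.
  by apply: (Defs.coord_continuous dy); exact: open_nbhs_nbhs.
pose NU := open_submanifold oU.
have fP (y : NU) : V (atlas i (set_val y)) by have [] := set_valP y.
pose f (y : NU) : open_domain oV := domain_pt oV (fP y).
have gP (q : open_domain oV) : exists y : NU, atlas i (set_val y) = set_val q.
  have [y dy yq] := VD _ (set_valP q).
  have Uy : U y by split=> //; rewrite /preimage /= yq; exact: set_valP.
  by exists (exist _ y (mem_set Uy)).
have [g gE] := choice gP.
have fK : cancel f g.
  move=> y; apply: val_inj; apply: (@coord_inj _ _ _ (atlas i)).
  - by rewrite inE; have [] := set_valP (g (f y)).
  - by rewrite inE; have [] := set_valP y.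
  exact: gE.
have gK : cancel g f by move=> q; apply: val_inj; exact: gE.
have dU (y : NU) : dom (atlas (i : atlas_index NU)) y by have [] := set_valP y.
have diff_f : diffeomorphism f.
  split.
    apply: (@smooth_map_chart _ _ NU (open_domain oV) i tt f id) => // b k.
    exact: Ck_coord.
  exists g; split=> //.
  apply: (@smooth_map_chart _ _ (open_domain oV) NU tt i g id) => // b k.
  exact: Ck_coord.
have jacf (i' : atlas_index NU) (j' : atlas_index (open_domain oV)) (y : NU) :
    jac f (atlas i') (atlas j') y =
    jac id (atlas i') (atlas (i : atlas_index NU)) y.
  have E : map_dom f (atlas i') (atlas j') =
      map_dom id (atlas i') (atlas (i : atlas_index NU)).
    by apply/seteqP; split=> z [? _]; split=> //; exact: dU.
  by rewrite /jac E.
have push : is_pushforward f (Defs.restrict oU s) (mvf_of oV F).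
  move=> i' j' y [yi' _]; rewrite mvf_ofE// jacf.
  have /asboolP[_ sT _] := componentsP (Defs.restrict oU s).
  rewrite -(sT i' i)//; first by rewrite Fs//; have [] := set_valP y.
  by split=> //; exact: dU.
have [nat1 nat2 _] := natD.
have Ux : U x by [].
pose x' : NU := exist _ x (mem_set Ux).
have := nat1 _ _ _ _ _ diff_f push i tt x' (conj (dU x') I).
rewrite -DvalE nat2 (@jacE _ _ _ _ _ _ _ _ id) //.
- by rewrite -/(jmx id _) jmx_id ext_map1.
- rewrite (_ : map_dom _ _ _ = setT); first exact: openT.
  by apply/seteqP; split=> // y _; split=> //; exact: dU.
Qed.

Lemma Dval_sub (V B : set 'rV[R]_m) (oV : open V) (oB : open B)
    (F : 'rV[R]_m -> ext R m) p : V `<=` B ->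
  (forall I, smooth B (fun p => F p I)) -> V p -> Dval oB F p = Dval oV F p.
Proof.
move=> VB sF Vp; pose x : open_domain oB := domain_pt oB (VB _ Vp).
rewrite -[p in LHS]/(set_val x) (@DvalE _ _ _ tt).
rewrite (@Dval_chart _ _ V oV _ F)//.
- by rewrite open_domain_image.
- by move=> I k; apply: Ck_sub VB (sF I k).
- by move=> y _ _; rewrite mvf_ofE.
Qed.

Lemma Dval_diffeo (V V' : set 'rV[R]_m) (oV : open V) (oV' : open V')
    (F F' : 'rV[R]_m -> ext R m) phi psi p :
  (forall p, V p -> V' (phi p)) -> (forall q, V' q -> V (psi q)) ->
  (forall p, V p -> psi (phi p) = p) -> (forall q, V' q -> phi (psi q) = q) ->
  (forall b, smooth V (fun p => phi p 0 b)) ->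
  (forall b, smooth V' (fun q => psi q 0 b)) ->
  (forall I, smooth V (fun p => F p I)) ->
  (forall I, smooth V' (fun p => F' p I)) ->
  (forall p, V p -> F' (phi p) = ext_map (jmx phi p) (F p)) ->
  V p -> Dval oV' F' (phi p) = ext_map (jmx phi p) (Dval oV F p).
Proof.
move=> VV' V'V phiK psiK sphi spsi sF sF' FF' Vp.
have fP (x : open_domain oV) : V' (phi (set_val x)) by apply: VV'; exact: set_valP.
have gP (x : open_domain oV') : V (psi (set_val x)) by apply: V'V; exact: set_valP.
pose f x : open_domain oV' := domain_pt oV' (fP x).
pose g x : open_domain oV := domain_pt oV (gP x).
have diff_f : diffeomorphism f.
  split.
    apply: (@smooth_map_chart _ _ (open_domain oV) (open_domain oV') tt tt f phi) => // b k.
    by rewrite open_domain_image; exact: sphi.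
  exists g; split=> [|x|x]; last 2 first.
  - by apply: val_inj; apply: phiK; exact: set_valP.
  - by apply: val_inj; apply: psiK; exact: set_valP.
  apply: (@smooth_map_chart _ _ (open_domain oV') (open_domain oV) tt tt g psi) => // b k.
  by rewrite open_domain_image; exact: spsi.
have jacf (i : atlas_index (open_domain oV)) (j : atlas_index (open_domain oV')) x :
    jac f (atlas i) (atlas j) x = jmx phi (set_val x).
  rewrite (@jacE _ _ _ _ _ _ _ _ phi) //.
  rewrite (_ : map_dom _ _ _ = setT); first exact: openT.
  by apply/seteqP.
have push : is_pushforward f (mvf_of oV F) (mvf_of oV' F').
  by move=> i j x _; rewrite !mvf_ofE// jacf FF'//; exact: set_valP.
have [nat1 _ _] := natD.
have := nat1 _ _ _ _ _ diff_f push tt tt (domain_pt oV Vp) (conj I I).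
by rewrite jacf -!DvalE.
Qed.

(** Naturality for local diffeomorphisms. Here phi and psi need to be inverse to
    each other only where the compositions make sense; the open sets
    A `&` phi^-1 A' and A' `&` psi^-1 A are then diffeomorphic. *)
Lemma Dval_local (B B' A A' : set 'rV[R]_m) (oB : open B) (oB' : open B')
    (F F' : 'rV[R]_m -> ext R m) phi psi p :
  open A -> open A' -> A `<=` B -> A' `<=` B' ->
  (forall p, A p -> A' (phi p) -> psi (phi p) = p) ->
  (forall q, A' q -> A (psi q) -> phi (psi q) = q) ->
  (forall b, smooth A (fun p => phi p 0 b)) ->
  (forall b, smooth A' (fun q => psi q 0 b)) ->
  (forall I, smooth B (fun p => F p I)) ->
  (forall I, smooth B' (fun p => F' p I)) ->
  (forall p, A p -> A' (phi p) -> F' (phi p) = ext_map (jmx phi p) (F p)) ->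
  A p -> A' (phi p) -> Dval oB' F' (phi p) = ext_map (jmx phi p) (Dval oB F p).
Proof.
move=> oA oA' AB A'B' phiK psiK sphi spsi sF sF' FF' Ap A'p.
have open_pre (C C' : set 'rV[R]_m) (h : 'rV[R]_m -> 'rV[R]_m) : open C -> open C' ->
    (forall b, smooth C (fun p => h p 0 b)) -> open (C `&` h @^-1` C').
  move=> oC oC' sh; rewrite openE => y [Cy C'y]; apply: filterI.
    exact: open_nbhs_nbhs.
  have ch : {for y, continuous h}.
    by apply: continuous_row => b; exact: Ck_continuous (sh b 0%N) Cy.
  by apply: ch; exact: open_nbhs_nbhs.
have oV := open_pre A A' phi oA oA' sphi.
have oV' := open_pre A' A psi oA' oA spsi.
rewrite (Dval_sub oV' oB')//; last 2 first.
- by move=> q [/A'B'].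
- by split=> //; rewrite /preimage /= phiK.
rewrite (Dval_sub oV oB)//; last by move=> q [/AB].
apply: (Dval_diffeo oV oV' (psi := psi)) => //.
- by move=> q [Aq A'q]; split=> //; rewrite /preimage /= phiK.
- by move=> q [A'q Aq]; split=> //; rewrite /preimage /= psiK.
- by move=> q [Aq A'q]; exact: phiK.
- by move=> q [A'q Aq]; exact: psiK.
- by move=> b k; apply: Ck_sub (sphi b k) => q [].
- by move=> b k; apply: Ck_sub (spsi b k) => q [].
- by move=> I k; apply: Ck_sub (sF I k) => q [/AB].
- by move=> I k; apply: Ck_sub (sF' I k) => q [/A'B'].
- by move=> q [Aq A'q]; exact: FF'.
Qed.

End Naturality.

(** * The components of a natural operator of degree -1 *)

Section Core.
Context {R : realType} {m : nat}.
Variable D : forall N : manifold R m, {linear mvf N -> mvf N}.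
Hypothesis natD : natural_operator D.
Variables (r : R) (r0 : 0 < r) (r1 : r <= 1).

Notation B := (ball (0 : 'rV[R]_m) r).
Let oB : open B := ball_open 0 r.

Variables (I J : {set 'I_m}) (a : 'I_m).
Hypotheses (Ia : a \in I) (Ja : a \notin J).

Notation rho := (scale_coord a).

(** The number c(f) of the introduction. *)
Definition coeff (f : 'rV[R]_m -> R) : R :=
  Dval D oB (fun p => monomial I (f p)) 0 J.

Let B0 : B 0. Proof. exact: ballxx. Qed.

Lemma jmx_scale_coord t (p : 'rV[R]_m) :
  jmx (rho t) p = \matrix_(i, j) ((if j == a then t else 1) * (i == j)%:R).
Proof.
apply/matrixP => i j; rewrite !mxE.
under eq_fun do rewrite scale_coordE.
have dj := is_derive_coord p i j.
have [_ ->] := @is_deriveZ _ _ _ _ (if j == a then t else 1) _ _ _ dj.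
by [].
Qed.

Lemma smooth_scale_coord (U V : set 'rV[R]_m) (t : R) f : open U -> open V ->
  (forall p, U p -> V (rho t p)) -> smooth V f -> smooth U (f \o rho t).
Proof.
move=> oU oV UV sf k; apply: Ck_comp (sf k) => // b.
apply: Ck_eq (CkM oU (Ck_cst U k (if b == a then t else 1)) (Ck_coord U k b)) => //.
by move=> p _; rewrite scale_coordE.
Qed.

Lemma smooth_monomial (U : set 'rV[R]_m) f K :
  smooth U f -> smooth U (fun p => monomial I (f p) K).
Proof.
move=> sf k; rewrite /monomial; under eq_fun do rewrite ffunE.
by case: (K == I); [exact: sf|exact: Ck_cst].
Qed.

Lemma coeff_ext f g : (forall p, B p -> f p = g p) -> coeff f = coeff g.
Proof.
move=> fg; rewrite /coeff /Dval; case: pselect => // B0'.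
rewrite (_ : mvf_of oB _ = mvf_of oB (fun p => monomial I (g p)))//.
rewrite /mvf_of; congr (insubd _ _); apply/funext => i; apply/funext => x.
by rewrite fg//; exact: set_valP.
Qed.

Lemma coeff_lin t f g : smooth B f -> smooth B g ->
  coeff (fun p => t * f p + g p) = t * coeff f + coeff g.
Proof.
move=> sf sg; rewrite /coeff /Dval; case: pselect => // B0'.
have -> : (fun p => monomial I (t * f p + g p)) =
    (fun p => t *: monomial I (f p) + monomial I (g p)).
  apply/funext => p; apply/ffunP => K; rewrite !ffunE.
  by case: ifP => // _; rewrite scaler0 addr0.
rewrite mvf_of_lin => [|K|K]; [|exact: smooth_monomial|exact: smooth_monomial].
by rewrite linearP mvf_linE !ffunE.
Qed.

Lemma coeffZ t f : smooth B f -> coeff (fun p => t * f p) = t * coeff f.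
Proof.
move=> sf; have s0 : smooth B (cst 0) by move=> k; exact: Ck_cst.
have c0 : coeff (cst 0) = 0.
  apply: (addrI (1 * coeff (cst 0))); rewrite -coeff_lin// addr0 mul1r.
  by apply: coeff_ext => p _; rewrite mul1r addr0.
rewrite -[RHS]addr0 -c0 -coeff_lin//.
by apply: coeff_ext => p _; rewrite addr0.
Qed.

(** The inclusion a \in I contributes the factor t and a \notin J contributes the
    factor 1. *)
Lemma coeff_scale t f : 0 < t <= 1 -> smooth B f ->
  coeff (f \o rho t) = t * coeff f.
Proof.
move=> /andP[t0 t1] sf.
have Bt p : B p -> B (rho t p) by apply: scale_coord_ball; rewrite gtr0_norm.
have srho s b : smooth B (fun p => rho s p 0 b).
  have := smooth_scale_coord (U := B) (t := s) oB openT _ (fun k => Ck_coord setT k b).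
  exact.
have := @Dval_local _ _ D natD B B B B oB oB (fun p => monomial I ((f \o rho t) p))
  (fun p => monomial I (t * f p)) (rho t) (rho t^-1) 0 oB oB.
rewrite scale_coord0 -/(coeff (f \o rho t)) => /(_ (@subset_refl _ _) (@subset_refl _ _)).
rewrite jmx_scale_coord => loc; rewrite -coeffZ// /coeff loc//.
- rewrite (ext_map_diag (a := a)) ?(negPf Ja) ?mul1r//.
    by move=> i j ij; rewrite mxE (negPf ij) mulr0.
  by move=> i ia; rewrite mxE (negPf ia) eqxx mul1r.
- by move=> p _ _; rewrite scale_coordM mulVf ?gt_eqF// scale_coord1.
- by move=> p _ _; rewrite scale_coordM mulfV ?gt_eqF// scale_coord1.
- move=> K; apply: smooth_monomial. exact: (@smooth_scale_coord B B).
- move=> K; apply: smooth_monomial => k.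
  exact: (CkM oB (Ck_cst B k t) (sf k)).
move=> p Bp _; rewrite jmx_scale_coord (ext_map_monomial (a := a))//.
  by rewrite mxE !eqxx mulr1.
by move=> i j ja; rewrite mxE (negPf ja) mul1r.
Qed.

(** Compare the homogeneity of f with the scaling rule for the ratio 1/2. *)
Lemma coeff_homogeneous t f : t != 2^-1 -> smooth B f ->
  (forall p, B p -> f (rho 2^-1 p) = t * f p) -> coeff f = 0.
Proof.
move=> t2 sf ft; have : coeff (f \o rho 2^-1) = 2^-1 * coeff f.
  by apply: coeff_scale => //; lra.
rewrite (coeff_ext ft) coeffZ// => /eqP.
by rewrite -subr_eq0 -mulrBl mulf_eq0 subr_eq0 (negPf t2) => /eqP.
Qed.

Lemma open_neq0 (h : 'rV[R]_m -> R) : smooth B h -> open (B `&` [set p | h p != 0]).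
Proof.
move=> sh; rewrite openE => y [By hy]; apply: filterI; first exact: open_nbhs_nbhs.
have /cvgrPdist_lt := Ck_continuous (sh 0%N) By.
move=> /(_ `|h y|); rewrite normr_gt0 => /(_ hy); apply: filterS => z.
by apply: contraTneq => /= ->; rewrite subr0 ltxx.
Qed.

Lemma derive_invariant (g : 'rV[R]_m -> R) p : (forall q, g (rho 0 q) = g q) ->
  'D_(delta_mx 0 a) g p = 0.
Proof.
move=> grho; rewrite /derive; apply/lim_near_cst => //; apply: nearW => h /=.
rewrite -grho [h *: _ + p]addrC scale_coord_line eqxx scale0r scaler0 addr0.
by rewrite grho subrr scaler0.
Qed.

(** With u = g x_a, the maps x_a |-> x_a / (1 - u) and x_a |-> x_a / (1 + u) are
    inverse to each other because g is constant along x_a, so that rho_s multiplies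
    u by s. *)
Lemma coeff_moebius (g : 'rV[R]_m -> R) : smooth B g -> (forall q, g (rho 0 q) = g q) ->
  coeff (fun p => g p * p 0 a) = 0.
Proof.
move=> sg grho0.
have grho t q : g (rho t q) = g q by rewrite -grho0 scale_coordM mul0r grho0.
pose u p := g p * p 0 a.
have urho t q : u (rho t q) = t * u q.
  by rewrite /u grho scale_coordE eqxx mulrCA.
have sx b : smooth B (fun p => p 0 b) by move=> k; exact: Ck_coord.
have scst c : smooth B (cst c) by move=> k; exact: Ck_cst.
have su : smooth B u by move=> k; exact: (CkM oB (sg k) (sx a k)).
have suu : smooth B (fun p => u p * u p) by move=> k; exact: (CkM oB (su k) (su k)).
pose den p := 1 - u p; pose den' p := 1 + u p.
have sden : smooth B den.
  move=> k; apply: Ck_eq (CkD oB (scst 1 k) (CkM oB (scst (-1) k) (su k))) => // p _.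
  by rewrite mulN1r.
have sden' : smooth B den' by move=> k; exact: (CkD oB (scst 1 k) (su k)).
pose phi p := rho (den p)^-1 p; pose psi p := rho (den' p)^-1 p.
have srho (A : set 'rV[R]_m) h b : open A -> A `<=` B -> smooth B h ->
    (forall p, A p -> h p != 0) -> smooth A (fun p => rho (h p)^-1 p 0 b).
  move=> oA AB sh h0 k.
  have CV := CkV oA h0 (Ck_sub AB (sh k)).
  apply: Ck_eq (CkM oA (f := fun p => if b == a then (h p)^-1 else 1) _
    (Ck_coord A k b)) => // [p _|]; first by rewrite scale_coordE.
  by case: (b == a) => //; exact: Ck_cst.
pose A := B `&` [set p | den p != 0]; pose A' := B `&` [set p | den' p != 0].
have u0 : u 0 = 0 by rewrite /u mxE mulr0.
have phi0 : phi 0 = 0 by rewrite /phi scale_coord0.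
have dphi_neq i j p : j != a -> jmx phi p i j = (i == j)%:R.
  move=> ja; rewrite mxE.
  rewrite (_ : (fun q => phi q 0 j) = (fun q => q 0 j)); last first.
    by apply/funext => q; rewrite scale_coordE (negPf ja) mul1r.
  by have [_ ->] := is_derive_coord p i j.
(* For i = a the last term vanishes and the right-hand side is
   (1 - u)^-1 + u (1 - u)^-2 = (1 - u)^-2; at p = 0 it is the Kronecker delta. *)
have dphi i p : A p -> jmx phi p i a = (den p)^-1 * (i == a)%:R +
    p 0 a * (den p ^- 2 *
      (g p * (i == a)%:R + p 0 a * 'D_(delta_mx 0 i) g p)).
  move=> [Bp denp]; rewrite mxE.
  rewrite (_ : (fun q => phi q 0 a) = (fun q => (den q)^-1 * q 0 a)); last first.
    by apply/funext => q; rewrite scale_coordE eqxx.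
  have dx := is_derive_coord p i a.
  have [_ /(_ i)[dg _]] := sg 1%N.
  have dgp := derivableP (dg _ Bp).
  have du : is_derive p (delta_mx 0 i) u _ := is_deriveM dgp dx.
  have dden : is_derive p (delta_mx 0 i) den _ :=
    is_deriveB (@is_derive_cst R 'rV[R]_m R 1 p (delta_mx 0 i)) du.
  have [dd dv] := dden.
  rewrite [LHS](deriveM (derivableV denp dd) (@ex_derive _ _ _ _ _ _ _ dx)).
  rewrite (deriveV denp dd) dv (@derive_val _ _ _ _ _ _ _ dx).
  by rewrite sub0r scalerN scaleNr opprK.
have := @Dval_local _ _ D natD B B A A' oB oB (fun p => monomial I 1)
  (fun p => monomial I (den' p ^+ 2)) phi psi 0 (open_neq0 sden) (open_neq0 sden').
rewrite phi0 => loc.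
have J0 : jmx phi 0 = 1%:M.
  apply/matrixP => i j; rewrite [RHS]mxE; have [->|ja] := eqVneq j a; last first.
    by rewrite dphi_neq.
  have A0 : A 0 by split=> //; rewrite /= /den u0 subr0 oner_neq0.
  by rewrite dphi// /den u0 subr0 invr1 mul1r [_ 0 a]mxE mul0r addr0.
(* Degree 0 in x_a. *)
have c1 : coeff (cst 1) = 0.
  apply: (@coeff_homogeneous 1) => // [|p _]; last by rewrite mul1r.
  by apply/eqP; lra.
(* Degree 2 in x_a. *)
have cuu : coeff (fun p => u p * u p) = 0.
  apply: (@coeff_homogeneous 4^-1) => // [|p _]; first by apply/eqP; lra.
  by rewrite urho mulrACA; congr (_ * _); field.
have cden : coeff (fun p => den' p ^+ 2) = coeff (cst 1).
  rewrite /coeff loc ?J0 ?ext_map1 //.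
  - by move=> p [].
  - by move=> p [].
  - move=> p [Bp denp] [_ den'p]; rewrite /psi /phi scale_coordM.
    rewrite (_ : _^-1 * _ = 1) ?scale_coord1// -invfM -[RHS]invr1; congr _^-1.
    rewrite /den' urho mulrDl mul1r mulrAC mulVf// mul1r /den.
    by rewrite subrK.
  - move=> p [Bp den'p] [_ denp]; rewrite /psi /phi scale_coordM.
    rewrite (_ : _^-1 * _ = 1) ?scale_coord1// -invfM -[RHS]invr1; congr _^-1.
    rewrite /den urho mulrBl mul1r mulrAC mulVf// mul1r /den'.
    by rewrite addrK.
  - by move=> b; apply: (srho A den b (open_neq0 sden)) => // p [].
  - by move=> b; apply: (srho A' den' b (open_neq0 sden')) => // p [].
  - by move=> K; exact: smooth_monomial (scst 1).
  - move=> K; apply: smooth_monomial => k.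
    by apply: Ck_eq (CkM oB (sden' k) (sden' k)).
  - move=> p Ap [_ den'p]; rewrite (ext_map_monomial (a := a))//; last first.
      by move=> i j ja; exact: dphi_neq.
    congr (monomial _ _); rewrite dphi// derive_invariant// eqxx.
    have [_ denp] := Ap; rewrite /den' urho -/(den p).
    have -> : u p = 1 - den p by rewrite /den opprB addrC subrK.
    rewrite mulr0 addr0 !mulr1 mulrCA -[p 0 a * g p]mulrC -/(u p).
    have -> : u p = 1 - den p by rewrite /den opprB addrC subrK.
    by field.
  - by split=> //; rewrite /= /den u0 subr0 oner_neq0.
  - by split=> //; rewrite /= /den' u0 addr0 oner_neq0.
have : coeff (fun p => 2 * u p + (1 * (u p * u p) + cst 1 p)) = 0.
  by rewrite -c1 -cden; apply: coeff_ext => p _; rewrite /den' /=; ring.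
rewrite coeff_lin// ?coeff_lin// ?cuu ?c1 ?mulr0 ?addr0.
  by move/eqP; rewrite mulf_eq0 pnatr_eq0 /= => /eqP.
by move=> k; exact: (CkD oB (CkM oB (scst 1 k) (suu k)) (scst 1 k)).
Qed.

Let model := open_domain oB.

Lemma open_pairs :
  open [set w : 'rV[R]_(m + m) | B (lsubmx w) /\ B (rsubmx w)].
Proof.
apply: (@openI _ [set w | B (lsubmx w)] [set w | B (rsubmx w)]).
  by apply: open_comp => // w _; exact: continuous_lsubmx.
by apply: open_comp => // w _; exact: continuous_rsubmx.
Qed.

(** The parameter space of the smooth family is the box B itself, the family being
    y |-> h(y, -) e_I; it is then restricted to the axis of the coordinate a. *)
Lemma coeff_continuous (h : 'rV[R]_(m + m) -> R) :
  smooth [set w | B (lsubmx w) /\ B (rsubmx w)] h ->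
  {for 0, continuous (fun t : R =>
    coeff (fun p => h (row_mx (t *: delta_mx 0 a) p)))}.
Proof.
move=> sh.
pose W := [set w : 'rV[R]_(m + m) | B (lsubmx w) /\ B (rsubmx w)].
have oW : open W := open_pairs.
pose s (y : model) : mvf model :=
  mvf_of oB (fun p => monomial I (h (row_mx (set_val y) p))).
pose c2 (i j : atlas_index model) (z : model * model) :=
  row_mx (atlas j z.1) (atlas i z.2).
have c2_inj i j : set_inj (dom (atlas j) `*` dom (atlas i)) (c2 i j).
  move=> [y x] [y' x'] _ _ /eq_row_mx[/= yy' xx'].
  by congr (_, _); exact: val_inj.
have c2_image i j : c2 i j @` (dom (atlas j) `*` dom (atlas i)) = W.
  apply/seteqP; split=> [_ [[y x] _ <-]|w [Bl Br]].
    by rewrite /W /= /c2 row_mxKl row_mxKr; split; exact: set_valP.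
  by exists (domain_pt oB Bl, domain_pt oB Br) => //; rewrite /c2 /= hsubmxK.
have srow (y : model) : smooth B (fun p => h (row_mx (set_val y) p)).
  move=> k; apply: (Ck_comp oB oW (phi := row_mx (set_val y)) _ _ (sh k)).
    by move=> p Bp; rewrite /W /= row_mxKl row_mxKr; split=> //; exact: set_valP.
  move=> b; rewrite /row_mx; under eq_fun do rewrite mxE.
  by case: (fintype.split b) => c; [exact: Ck_cst|exact: Ck_coord].
have sfam : smooth_family s.
  move=> j i K.
  apply: (@smooth_viaP _ _ _ _ _ _ (fun w => monomial I (h w) K)).
  - exact: c2_inj.
  - by rewrite c2_image.
  - move=> [y x] _ /=; rewrite /s mvf_ofE// => K'.
    exact: smooth_monomial (srow y).
  - rewrite c2_image => k; rewrite /monomial; under eq_fun do rewrite ffunE.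
    by case: (K == I); [exact: sh|exact: Ck_cst].
have [_ _ nat3] := natD.
have := nat3 _ _ _ _ sfam tt tt J 0%N.
rewrite -/(c2 tt tt) c2_image => -[cW _].
have W0 : W (row_mx (0 *: delta_mx 0 a) 0).
  by rewrite /W /= row_mxKl row_mxKr scale0r.
pose path (t : R) : 'rV[R]_(m + m) := row_mx (t *: delta_mx 0 a) 0.
have cpath : {for 0, continuous path}.
  apply: continuous_row => b; rewrite /path /row_mx.
  rewrite /prop_for /continuous_at mxE; under eq_fun do rewrite mxE.
  case: (fintype.split b) => c; last exact: cvg_cst.
  rewrite mxE; under eq_fun do rewrite mxE.
  apply: (@continuousM R R id (cst _) 0); [exact: cvg_id|exact: cvg_cst].
have cLR := continuous_comp cpath (cW _ W0).
set LR := (X in {for 0, continuous (X \o path)}) in cLR.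
have LRE (t : R) : B (t *: delta_mx 0 a) ->
    LR (path t) = coeff (fun p => h (row_mx (t *: delta_mx 0 a) p)).
  move=> Bt; rewrite -[path t]/(c2 tt tt (domain_pt oB Bt, domain_pt oB B0)) /LR.
  rewrite (local_repE (c := c2 tt tt) _ (@c2_inj tt tt)) //.
  by rewrite /coeff -[0 in RHS]/(set_val (domain_pt oB B0)) (@DvalE _ _ D _ oB _ tt).
have Bnear : \forall t \near (0 : R), B (t *: delta_mx 0 a).
  have cv : {for 0, continuous (fun t : R => t *: (delta_mx 0 a : 'rV[R]_m))}.
    exact: scalel_continuous.
  by apply: cv; rewrite scale0r; exact: nbhsx_ballx.
have nearE : \forall t \near (0 : R),
    LR (path t) = coeff (fun p => h (row_mx (t *: delta_mx 0 a) p)).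
  by apply: filterS Bnear => t; exact: LRE.
rewrite /prop_for /continuous_at -LRE; last by rewrite scale0r.
by apply: cvg_trans cLR; exact: near_eq_cvg.
Qed.

(** Only the coefficient of x_a in the expansion of f matters, and it may be
    frozen at x_a = 0 by letting the scaling parameter t tend to 0. *)
Lemma coeff_eq0 f : smooth B f -> coeff f = 0.
Proof.
move=> sf.
have starB p t : B p -> t \in `[0, 1] -> B (rho t p).
  move=> Bp; rewrite in_itv/= => /andP[t0 t1].
  by apply: scale_coord_ball Bp; rewrite ger0_norm.
have sx : smooth B (fun p => p 0 a) by move=> k; exact: Ck_coord.
have [q sq qE] : exists2 q, smooth B q &
    forall p, B p -> f p = f (rho 0 p) + p 0 a * q p.
  exists (radial_mean a 0 ('D_(delta_mx 0 a) f)).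
    move=> k; apply: smooth_radial_mean => // k'.
    by have [_ /(_ a)[]] := sf k'.+1.
  by move=> p; exact: Hadamard (sf 1%N).
have srho t g : t \in `[0, 1] -> smooth B g -> smooth B (g \o rho t).
  by move=> t01; apply: smooth_scale_coord => // p Bp; exact: starB.
have in01 (t : R) : 0 < t <= 1 -> t \in `[0, 1].
  by rewrite in_itv/= => /andP[/ltW -> ->].
have i0 : (0 : R) \in `[0, 1] by rewrite in_itv/= lexx ler01.
have sxq t : t \in `[0, 1] -> smooth B (fun p => p 0 a * q (rho t p)).
  by move=> t01 k; exact: (CkM oB (sx k) (srho t q t01 sq k)).
have f0 : coeff (f \o rho 0) = 0.
  apply: (@coeff_homogeneous 1) => [||p _]; first by apply/eqP; lra.
    exact: srho.
  by rewrite /= scale_coordM mul0r mul1r.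
have cq t : 0 < t <= 1 -> coeff (fun p => p 0 a * q (rho t p)) = coeff f.
  move=> t01; apply: (mulfI (x := t)); first by case/andP: t01 => /gt_eqF ->.
  have cf : coeff f = coeff (fun p => p 0 a * q p).
    transitivity (coeff (fun p => 1 * (f \o rho 0) p + p 0 a * q p)).
      by apply: coeff_ext => p Bp; rewrite mul1r -qE.
    rewrite coeff_lin ?f0 ?mulr0 ?add0r//; first exact: srho.
    by move=> k; exact: (CkM oB (sx k) (sq k)).
  have sxq1 : smooth B (fun p => p 0 a * q p).
    by move=> k; exact: (CkM oB (sx k) (sq k)).
  rewrite cf -(coeff_scale t01 sxq1) -(coeffZ t (sxq t (in01 t t01))).
  by apply: coeff_ext => p _; rewrite /= scale_coordE eqxx mulrA.
have c0 : coeff (fun p => p 0 a * q (rho 0 p)) = 0.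
  rewrite (coeff_ext (g := fun p => (q \o rho 0) p * p 0 a)); last first.
    by move=> p _; rewrite mulrC.
  apply: coeff_moebius; first exact: srho.
  by move=> p; rewrite /= scale_coordM mul0r.
(* The first m coordinates are the parameter, whose coordinate a is used as t. The
   bound r <= 1 keeps |t| below 1, so that rho t maps B to itself. *)
pose h (w : 'rV[R]_(m + m)) : R :=
  rsubmx w 0 a * q (rho (lsubmx w 0 a) (rsubmx w)).
have hE (t : R) p : h (row_mx (t *: delta_mx 0 a) p) = p 0 a * q (rho t p).
  by rewrite /h row_mxKl row_mxKr !mxE !eqxx mulr1.
have sh : smooth [set w | B (lsubmx w) /\ B (rsubmx w)] h.
  move=> k.
  have oW := open_pairs.
  have slr b : Ck k [set w | B (lsubmx w) /\ B (rsubmx w)]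
      (fun w : 'rV[R]_(m + m) => rsubmx w 0 b).
    by apply: Ck_eq (Ck_coord _ k (rshift m b)) => // w _; rewrite [RHS]mxE.
  apply: (CkM oW (slr a)).
  apply: (Ck_comp oW oB (phi := fun w => rho (lsubmx w 0 a) (rsubmx w)) _ _ (sq k)).
    move=> w [/ball_rowP[_ Bl] Br]; apply: scale_coord_ball Br.
    by have := Bl a; rewrite !mxE sub0r normrN => /ltW/le_trans; exact.
  move=> b; apply: Ck_eq (CkM oW (f := fun w : 'rV[R]_(m + m) =>
      if b == a then lsubmx w 0 a else 1) _ (slr b)) => // [w _|].
    by rewrite scale_coordE.
  case: (b == a); last exact: Ck_cst.
  by apply: Ck_eq (Ck_coord _ k (lshift m a)) => // w _; rewrite [RHS]mxE.
have kE (t : R) : coeff (fun p => h (row_mx (t *: delta_mx 0 a) p)) =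
    coeff (fun p => p 0 a * q (rho t p)) by apply: coeff_ext => p _; exact: hE.
have /cvgrPdist_lt kcont := coeff_continuous sh.
apply/eqP; apply: contraT; rewrite -normr_gt0 => /kcont/nbhs_ballP[e /= e0 eP].
(* A positive t at which c is both equal to c(f) and close to its limit 0. *)
pose t := Num.min (e / 2) 1.
have t0 : 0 < t by rewrite lt_min ltr01 divr_gt0.
have t1 : t <= 1 by rewrite ge_min lexx orbT.
have te : t < e by rewrite gt_min; apply/orP; left; lra.
have := eP t; rewrite -ball_normE /= sub0r normrN gtr0_norm// => /(_ te).
by rewrite !kE c0 cq ?t0// sub0r normrN ltxx.
Qed.

End Core.

(** * Vanishing *)

Section Vanishing.
Context {R : realType} {m : nat}.

Lemma mvf_of_sum (V : set 'rV[R]_m) (oV : open V) (F : 'rV[R]_m -> ext R m) :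
  (forall I, smooth V (fun p => F p I)) ->
  mvf_of oV F = \sum_I mvf_of oV (fun p => monomial I (F p I)).
Proof.
move=> sF; apply: val_inj; apply/funext => i; apply/funext => x.
have sumE (G : {set 'I_m} -> mvf (open_domain oV)) :
    (\sum_I G I) i x = \sum_I (G I i x) :> ext R m.
  exact: (big_morph (fun t : mvf (open_domain oV) => t i x)).
rewrite [RHS]sumE [LHS]mvf_ofE//; apply/ffunP => J; rewrite sum_ffunE.
rewrite (bigD1 J)//= big1 => [|I IJ].
  by rewrite mvf_ofE ?ffunE ?eqxx ?addr0// => I; exact: smooth_monomial.
rewrite mvf_ofE => [|K]; last exact: smooth_monomial.
by rewrite ffunE eq_sym (negPf IJ).
Qed.

Variable D : forall N : manifold R m, {linear mvf N -> mvf N}.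
Hypotheses (codiffD : forall N, codifferential (D N)) (natD : natural_operator D).

(** If I is contained in J, the component along e_J vanishes because D lowers the
    degree by one; otherwise some a in I is missing in J. *)
Lemma monomial_eq0 r (r0 : 0 < r) (r1 : r <= 1) (I : {set 'I_m}) f :
  smooth (ball (0 : 'rV[R]_m) r) f ->
  Dval D (ball_open (0 : 'rV[R]_m) r) (fun p => monomial I (f p)) 0 = 0.
Proof.
move=> sf; set oB := ball_open _ _; pose F p := monomial I (f p).
have B0 : ball (0 : 'rV[R]_m) r 0 by exact: ballxx.
have hF : homog #|I| (mvf_of oB F).
  move=> i x K; rewrite mvf_ofE => [|L]; last exact: smooth_monomial.
  by rewrite ffunE; case: ifPn => [/eqP->//|_]; rewrite eqxx.
have [D0 DS _] := codiffD (open_domain oB).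
apply/ffunP => J; rewrite ffunE.
have [IJ|/subsetPn[a Ia Ja]] := boolP (I \subset J); last first.
  exact: (coeff_eq0 natD r0 r1 Ia Ja sf).
rewrite -[0 in LHS]/(set_val (domain_pt oB B0)) (@DvalE _ _ D _ oB _ tt).
case cI : #|I| hF => [|n] hF; first by rewrite D0// ffunE.
apply/eqP; apply: contraT => /(DS _ _ hF) cJ.
by have := subset_leq_card IJ; rewrite cI cJ ltnn.
Qed.

(** Read s in a chart around x and move x to the origin by a translation. *)
Lemma natural_codifferential_eq0 N (s : mvf N) : D N s = 0.
Proof.
apply: val_inj; apply/funext => i; apply/funext => x.
rewrite [RHS](_ : _ = 0) //.
have /asboolP[Ds0 _ _] := componentsP (D N s).
have [dx|] := pselect (dom (atlas i) x); last exact: Ds0.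
pose V := atlas i @` dom (atlas i).
have oV : open V by apply: coord_open => //; exact: dom_open.
pose F p : ext R m := [ffun I => local_rep (dom (atlas i)) (atlas i)
  (fun x => s i x I) p].
have sF I : smooth V (fun p => F p I).
  have /asboolP[_ _ sS] := componentsP s.
  by move=> k; under eq_fun do rewrite ffunE; exact: sS.
have Vx : V (atlas i x) by exists x.
rewrite -[LHS]/(D N s i x) (@Dval_chart _ _ D natD N i V oV s F)//; last first.
  move=> y dy _; apply/ffunP => I; rewrite ffunE local_repE//.
  exact: coord_inj.
set p0 := atlas i x.
have [e /= e0 eV] : nbhs_ball p0 V.
  by apply/nbhs_ballP; exact: open_nbhs_nbhs.
pose r := Num.min e 1.
have r0 : 0 < r by rewrite lt_min e0 ltr01.
have r1 : r <= 1 by rewrite ge_min lexx orbT.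
have rV : ball p0 r `<=` V.
  by apply: subset_trans eV; apply: le_ball; rewrite ge_min lexx.
pose oB := ball_open (0 : 'rV[R]_m) r.
pose shift q : 'rV[R]_m := q + p0.
have Bshift q : ball 0 r q -> ball p0 r (shift q).
  move=> /ball_rowP[_ Bq]; apply/ball_rowP; split=> // b.
  by have := Bq b; rewrite !mxE sub0r addrC opprD addrA subrr sub0r.
have sshift (U : set 'rV[R]_m) b c k : open U -> Ck k U (fun q => (q + c) 0 b).
  move=> oU; apply: Ck_eq (CkD oU (Ck_coord U k b) (Ck_cst U k (c 0 b))) => // q _.
  by rewrite mxE.
have sF' I : smooth (ball 0 r) (fun q => F (shift q) I).
  move=> k; apply: (Ck_comp oB oV (phi := shift) _ _ (sF I k)).
    by move=> q /Bshift/rV.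
  by move=> b; exact: sshift.
have := @Dval_local _ _ D natD V (ball 0 r) (ball p0 r) (ball 0 r) oV oB F
  (F \o shift) (fun p => p - p0) shift p0 (ball_open _ _) oB rV (@subset_refl _ _).
rewrite subrr => loc.
have J1 p : jmx (fun p => p - p0) p = 1%:M.
  apply/matrixP => a b; rewrite !mxE.
  have := is_deriveD (is_derive_coord p a b)
    (@is_derive_cst R 'rV[R]_m R (- p0 0 b) p (delta_mx 0 a)).
  rewrite (_ : _ + cst _ = fun q : 'rV[R]_m => (q - p0) 0 b).
    by case=> _ ->; rewrite addr0.
  by apply/funext => q; rewrite !mxE.
rewrite J1 ext_map1 in loc; rewrite -loc//.
- rewrite /Dval; case: pselect => // B0.
  rewrite mvf_of_sum// linear_sum.
  rewrite (big_morph (fun t : mvf (open_domain oB) => t tt (domain_pt oB B0)) (id1 := 0)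
    (op1 := +%R)) //.
  apply: big1 => I _.
  have := @monomial_eq0 _ r0 r1 I _ (sF' I).
  by rewrite /Dval; case: pselect => // B0'; rewrite (Prop_irrelevance B0' B0).
- by move=> p _ _; rewrite /shift subrK.
- by move=> p _ _; rewrite /shift addrK.
- by move=> b k; exact: sshift (ball_open _ _).
- by move=> b k; exact: sshift oB.
- by move=> p _ _; rewrite J1 ext_map1 /= /shift subrK.
- exact: ballxx.
- exact: ballxx.
Qed.

End Vanishing.

Theorem theorem2p13 (R : realType) (m : nat) (M : manifold R m)
    (d : {linear mvf M -> mvf M}) :
  naturally_defined_codifferential d <-> (forall s : mvf M, d s = 0).
Proof.
split=> [[D [codiffD natD Dd]] s|d0].
  by rewrite -Dd; exact: natural_codifferential_eq0.
have mvf0E (N : manifold R m) i x I : (0 : mvf N) i x I = 0 by rewrite ffunE.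
exists (fun N => \0 : {linear mvf N -> mvf N}); split => [N||s]; last 1 first.
- by rewrite d0.
- by split=> // n s _ i x I; rewrite mvf0E eqxx.
split=> [N N' f s s' _ _ i j x _|N U oU s|k P N s _ j i I].
- apply/ffunP => K; rewrite mvf0E ffunE big1// => I _.
  by rewrite mvf0E mulr0.
- by apply: val_inj; apply/funext => i; apply/funext => x.
- rewrite [X in smooth_via _ _ X](_ : _ = cst 0); first exact: smooth_via0.
  by apply/funext => q; rewrite mvf0E.
Qed.
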